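(* Let $\Bbbk$ be an algebraically closed field, let $G$ be an affine algebraic group over $\Bbbk$, and let $R$ be an associative $\Bbbk$-algebra with $1$ on which $G$ acts rationally by $\Bbbk$-algebra automorphisms. Let $P$ be a rational ideal of $R$. Then the following are equivalent: (a) $P$ is locally closed in $\operatorname{Spec} R$; (b) $P{:}G=\bigcap_{g\in G} g.P$ is locally closed in $G\text{-}\operatorname{Spec} R$.
   Context: The action of $G$ on $R$ is rational if $R$ is a union of finite-dimensional $G$-stable subspaces $V$ on each of which $G$ acts via a homomorphism of algebraic groups $G\to \operatorname{GL}(V)$. Extended centroid: for a ring $U$, let $\mathcal E$ be the filter of all two-sided ideals $I$ of $U$ with zero left annihilator $\{u\in U\mid uI=0\}$; the (right) Amitsur-Martindale ring of quotients of $U$ is $\varinjlim_{I\in\mathcal E}\operatorname{Hom}(I_U,U_U)$, and the extended centroid $\mathcal C(U)$ is its center. If $U$ is prime, $\mathcal C(U)$ is a field. $\operatorname{Spec} R$ is the set of prime ideals of $R$ with the Jacobson-Zariski topology: the closed sets are $\mathbf V(I)=\{P\in\operatorname{Spec}R\mid P\supseteq I\}$ for $I\subseteq R$. A prime $P$ of $R$ is rational if $\mathcal C(R/P)=\Bbbk$. A proper $G$-stable ideal $I$ of $R$ is $G$-prime if $AB\subseteq I$ for $G$-stable ideals $A,B$ of $R$ implies $A\subseteq I$ or $B\subseteq I$. $G\text{-}\operatorname{Spec}R$ is the set of all $G$-prime ideals of $R$. The map $\gamma\colon\operatorname{Spec}R\to G\text{-}\operatorname{Spec}R$, $P\mapsto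 P{:}G=\bigcap_{g\in G}g.P$, is surjective, and $G\text{-}\operatorname{Spec}R$ carries the final topology for $\gamma$ (a subset is closed iff its preimage under $\gamma$ is closed). A point $x$ of a topological space $X$ is locally closed if $\{x\}$ is open in its closure in $X$. *)

(* Defs.v *)
From HB Require Import structures.
From mathcomp Require Import all_boot all_order all_algebra.
From mathcomp Require Import all_classical.
From mathcomp Require Import topology_structure.
From mathcomp Require Import mpoly.

Set Implicit Arguments.
Unset Strict Implicit.
Unset Printing Implicit Defensive.

Import GRing.Theory.
Local Open Scope classical_set_scope.
Local Open Scope quotient_scope.
Local Open Scope ring_scope.

Section Ideals.
Variable U : pzRingType.
Implicit Types (I J K S : set U).

Definition add_subgroup S := S 0 /\ (forall x y, S x -> S y -> S (x - y)).

Definition two_sided_ideal I :=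
  [/\ add_subgroup I, (forall a x, I x -> I (a * x))
    & (forall a x, I x -> I (x * a))].

Definition ideal_mul I J : set U :=
  smallest add_subgroup [set x * y | x in I & y in J].

Definition prime_ideal P :=
  [/\ two_sided_ideal P, P != setT
    & forall A B, two_sided_ideal A -> two_sided_ideal B ->
        ideal_mul A B `<=` P -> A `<=` P \/ B `<=` P].

(* The ideals of the filter whose direct limit is the ring of quotients. *)
Definition null_lann_ideal I :=
  two_sided_ideal I /\ (forall u, (forall x, I x -> u * x = 0) -> u = 0).

Lemma add_subgroupN S x : add_subgroup S -> S x -> S (- x).
Proof. by move=> [S0 SB] Sx; rewrite -[- x]add0r; apply: SB. Qed.

Lemma add_subgroupD S x y : add_subgroup S -> S x -> S y -> S (x + y).
Proof.
by move=> hS Sx Sy; rewrite -[y]opprK; apply: hS.2 => //; apply: add_subgroupN.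
Qed.

Lemma add_subgroupT : add_subgroup setT. Proof. by []. Qed.

Lemma two_sided_idealT : two_sided_ideal setT. Proof. by []. Qed.

Lemma two_sided_idealI I J :
  two_sided_ideal I -> two_sided_ideal J -> two_sided_ideal (I `&` J).
Proof.
move=> [[I0 IB] Il Ir] [[J0 JB] Jl Jr]; split; first split=> //.
- by move=> x y [? ?] [? ?]; split; [apply: IB|apply: JB].
- by move=> a x [? ?]; split; [apply: Il|apply: Jl].
- by move=> a x [? ?]; split; [apply: Ir|apply: Jr].
Qed.

Lemma ideal_mul_sub I J S : add_subgroup S ->
  (forall x y, I x -> J y -> S (x * y)) -> ideal_mul I J `<=` S.
Proof.
by move=> hS h; apply: smallest_sub => // _ [x Ix [y Jy <-]]; exact: h.
Qed.

Lemma ideal_mul_gen I J x y : I x -> J y -> ideal_mul I J (x * y).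
Proof.
by move=> Ix Jy; apply: sub_gen_smallest; exists x => //; exists y.
Qed.

Lemma add_subgroup_ideal_mul I J : add_subgroup (ideal_mul I J).
Proof.
split=> [S [[S0 _] _]|x y hx hy S [hS hG]] //.
by apply: hS.2; [apply: hx|apply: hy].
Qed.

Lemma ideal_mulS I I' J J' : I `<=` I' -> J `<=` J' ->
  ideal_mul I J `<=` ideal_mul I' J'.
Proof.
move=> hI hJ; apply: ideal_mul_sub; first exact: add_subgroup_ideal_mul.
by move=> x y /hI ? /hJ ?; exact: ideal_mul_gen.
Qed.

Lemma ideal_mul_subI I J : two_sided_ideal I -> two_sided_ideal J ->
  ideal_mul I J `<=` I `&` J.
Proof.
move=> hI hJ; apply: ideal_mul_sub; first by case: (two_sided_idealI hI hJ).
by move=> x y Ix Jy; split; [case: hI => _ _; apply|case: hJ => _ + _; apply].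
Qed.

Lemma two_sided_ideal_mul I J : two_sided_ideal I -> two_sided_ideal J ->
  two_sided_ideal (ideal_mul I J).
Proof.
move=> [_ Il _] [_ _ Jr]; have hM := add_subgroup_ideal_mul I J; split=> //.
- move=> a; apply: (@ideal_mul_sub _ _ [set x | ideal_mul I J (a * x)]).
    split=> [|x y /= hx hy]; first by rewrite /= mulr0; case: hM.
    by rewrite mulrBr; apply: hM.2.
  by move=> x y Ix Jy; rewrite /= mulrA; apply: ideal_mul_gen => //; exact: Il.
- move=> a; apply: (@ideal_mul_sub _ _ [set x | ideal_mul I J (x * a)]).
    split=> [|x y /= hx hy]; first by rewrite /= mul0r; case: hM.
    by rewrite mulrBl; apply: hM.2.
  by move=> x y Ix Jy; rewrite /= -mulrA; apply: ideal_mul_gen => //; exact: Jr.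
Qed.

Lemma null_lannT : null_lann_ideal setT.
Proof. by split=> // u /(_ 1 Logic.I); rewrite mulr1. Qed.

Lemma null_lannM I J : null_lann_ideal I -> null_lann_ideal J ->
  null_lann_ideal (ideal_mul I J).
Proof.
move=> [hI nI] [hJ nJ]; split; first exact: two_sided_ideal_mul.
move=> u hu; apply: nI => x Ix; apply: nJ => y Jy.
by rewrite -mulrA; apply: hu; exact: ideal_mul_gen.
Qed.

Lemma null_lannI I J : null_lann_ideal I -> null_lann_ideal J ->
  null_lann_ideal (I `&` J).
Proof.
move=> hI hJ; have [_ nIJ] := null_lannM hI hJ.
split; first by apply: two_sided_idealI; [case: hI|case: hJ].
move=> u hu; apply: nIJ => x hx; apply: hu.
exact: (ideal_mul_subI (proj1 hI) (proj1 hJ) hx).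
Qed.

Lemma prime_idealP P x y : prime_ideal P ->
  (forall r, P (x * r * y)) -> P x \/ P y.
Proof.
move=> [[[P0 PB] Pl Pr] _ hP] hxy.
pose A : set U := [set a | forall r, P (a * r * y)].
pose B : set U := [set b | forall a r, A a -> P (a * r * b)].
have hA : two_sided_ideal A.
  split; first split=> [r|a b ha hb r].
  - by rewrite !mul0r.
  - by rewrite !mulrBl; apply: PB; [apply: ha|apply: hb].
  - by move=> c a ha r; rewrite -!mulrA; apply: Pl; rewrite mulrA; apply: ha.
  - by move=> c a ha r; rewrite -(mulrA a); apply: ha.
have hB : two_sided_ideal B.
  split; first split=> [a r _|b c hb hc a r ha].
  - by rewrite mulr0.
  - by rewrite mulrBr; apply: PB; [apply: hb|apply: hc].
  - by move=> c b hb a r ha; rewrite mulrA -(mulrA a); apply: hb.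
  - by move=> c b hb a r ha; rewrite mulrA; apply: Pr; apply: hb.
case: (hP A B hA hB).
- apply: ideal_mul_sub => // a b ha hb.
  by have := hb a 1 ha; rewrite mulr1.
- by move=> AP; left; apply: AP => r; apply: hxy.
- by move=> BP; right; apply: BP => a r; apply.
Qed.

End Ideals.

Section QuotientRing.
Variables (U : pzRingType) (I : set U) (hI : two_sided_ideal I).

Definition quo_equiv (x y : U) : bool := `[< I (x - y) >].

Let IG : add_subgroup I. Proof. by case: hI. Qed.

Lemma quo_equiv_refl : reflexive quo_equiv.
Proof. by move=> x; apply/asboolP; rewrite subrr; case: IG. Qed.

Lemma quo_equiv_sym : ssrbool.symmetric quo_equiv.
Proof.
by move=> x y; apply/asboolP/asboolP => /(add_subgroupN IG); rewrite opprB.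
Qed.

Lemma quo_equiv_trans : transitive quo_equiv.
Proof.
move=> y x z /asboolP h1 /asboolP h2; apply/asboolP.
by rewrite -(subrK y x) -addrA; apply: add_subgroupD.
Qed.

Definition quo_equiv_canonical :=
  EquivRel quo_equiv quo_equiv_refl quo_equiv_sym quo_equiv_trans.

Definition quo_ring := {eq_quot quo_equiv_canonical}.
HB.instance Definition _ := Choice.on quo_ring.

Definition quo_pi (x : U) : quo_ring := \pi_quo_ring x.

Lemma quo_piP x y : reflect (I (x - y)) (quo_pi x == quo_pi y).
Proof. by apply: (iffP eqP) => [/eqmodP/asboolP|h] //; apply/eqmodP/asboolP. Qed.

Lemma quo_ind (P : quo_ring -> Prop) :
  (forall x, P (quo_pi x)) -> forall q, P q.
Proof. by move=> h q; rewrite -[q]reprK; apply: h. Qed.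

Definition quo_add (p q : quo_ring) := quo_pi (repr p + repr q).
Definition quo_mul (p q : quo_ring) := quo_pi (repr p * repr q).
Definition quo_opp (p : quo_ring) := quo_pi (- repr p).

Lemma quo_repr x : I (repr (quo_pi x) - x).
Proof. by apply/quo_piP; rewrite /quo_pi reprK. Qed.

Lemma quo_addE x y : quo_add (quo_pi x) (quo_pi y) = quo_pi (x + y).
Proof.
apply/eqP/quo_piP; rewrite opprD addrACA.
by apply: add_subgroupD => //; exact: quo_repr.
Qed.

Lemma quo_oppE x : quo_opp (quo_pi x) = quo_pi (- x).
Proof.
by apply/eqP/quo_piP; rewrite -opprD; apply: add_subgroupN => //; exact: quo_repr.
Qed.

Lemma quo_mulE x y : quo_mul (quo_pi x) (quo_pi y) = quo_pi (x * y).
Proof.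
apply/eqP/quo_piP; case: hI => _ Il Ir.
set a := repr _; set b := repr _.
have -> : a * b - x * y = a * (b - y) + (a - x) * y.
  by rewrite mulrBr mulrBl addrA subrK.
by apply: add_subgroupD => //; [apply: Il|apply: Ir]; exact: quo_repr.
Qed.

Fact quo_addA : associative quo_add.
Proof.
by elim/quo_ind=> x; elim/quo_ind=> y; elim/quo_ind=> z; rewrite !quo_addE addrA.
Qed.
Fact quo_addC : commutative quo_add.
Proof. by elim/quo_ind=> x; elim/quo_ind=> y; rewrite !quo_addE addrC. Qed.
Fact quo_add0 : left_id (quo_pi 0) quo_add.
Proof. by elim/quo_ind=> x; rewrite quo_addE add0r. Qed.
Fact quo_addN : left_inverse (quo_pi 0) quo_opp quo_add.
Proof. by elim/quo_ind=> x; rewrite quo_oppE quo_addE addNr. Qed.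
Fact quo_mulA : associative quo_mul.
Proof.
by elim/quo_ind=> x; elim/quo_ind=> y; elim/quo_ind=> z; rewrite !quo_mulE mulrA.
Qed.
Fact quo_mul1l : left_id (quo_pi 1) quo_mul.
Proof. by elim/quo_ind=> x; rewrite quo_mulE mul1r. Qed.
Fact quo_mul1r : right_id (quo_pi 1) quo_mul.
Proof. by elim/quo_ind=> x; rewrite quo_mulE mulr1. Qed.
Fact quo_mulDl : left_distributive quo_mul quo_add.
Proof.
elim/quo_ind=> x; elim/quo_ind=> y; elim/quo_ind=> z.
by rewrite !(quo_mulE, quo_addE) mulrDl.
Qed.
Fact quo_mulDr : right_distributive quo_mul quo_add.
Proof.
elim/quo_ind=> x; elim/quo_ind=> y; elim/quo_ind=> z.
by rewrite !(quo_mulE, quo_addE) mulrDr.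
Qed.

HB.instance Definition _ := GRing.isPzRing.Build quo_ring
  quo_addA quo_addC quo_add0 quo_addN quo_mulA quo_mul1l quo_mul1r
  quo_mulDl quo_mulDr.

End QuotientRing.

Section AmitsurMartindale.
Variable U : pzRingType.

(* An element of Hom(I_U, U_U). The function is total for convenience, but its
   values outside of the domain I are irrelevant: only its restriction to I is
   constrained, and am_equiv below only compares restrictions. *)
Record am_hom := AMHom {
  am_dom : set U;
  am_fun :> U -> U;
  am_domP : null_lann_ideal am_dom;
  am_funD : forall x y, am_dom x -> am_dom y ->
    am_fun (x + y) = am_fun x + am_fun y;
  am_funM : forall x a, am_dom x -> am_fun (x * a) = am_fun x * a
}.
HB.instance Definition _ := gen_eqMixin am_hom.
HB.instance Definition _ := gen_choiceMixin am_hom.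

Implicit Types f g h : am_hom.

Definition am_equiv f g : bool :=
  `[< exists K : set U, [/\ null_lann_ideal K, K `<=` am_dom f,
        K `<=` am_dom g & forall x, K x -> f x = g x] >].

Lemma am_equiv_on f g :
  (forall x, am_dom f x -> am_dom g x -> f x = g x) -> am_equiv f g.
Proof.
move=> h; apply/asboolP; exists (am_dom f `&` am_dom g); split.
- by apply: null_lannI; exact: am_domP.
- by move=> x [].
- by move=> x [].
- by move=> x [? ?]; exact: h.
Qed.

Lemma am_equiv_refl : reflexive am_equiv.
Proof. by move=> f; apply: am_equiv_on. Qed.

Lemma am_equiv_sym : ssrbool.symmetric am_equiv.
Proof.
by move=> f g; apply/asboolP/asboolP => -[K [h1 h2 h3 h4]]; exists K; split=> //;
  move=> x /h4.
Qed.

Lemma am_equiv_trans : transitive am_equiv.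
Proof.
move=> g f h /asboolP[K [K1 K2 K3 K4]] /asboolP[L [L1 L2 L3 L4]].
apply/asboolP; exists (K `&` L); split.
- exact: null_lannI.
- by move=> x [/K2].
- by move=> x [_ /L3].
- by move=> x [/K4 -> /L4].
Qed.

Definition am_equiv_canonical :=
  EquivRel am_equiv am_equiv_refl am_equiv_sym am_equiv_trans.

Definition am_ring := {eq_quot am_equiv_canonical}.
HB.instance Definition _ := Choice.on am_ring.

Definition am_pi f : am_ring := \pi_am_ring f.

Lemma am_piP f g : am_equiv f g -> am_pi f = am_pi g.
Proof. by move=> h; rewrite /am_pi; apply/eqmodP. Qed.

Lemma am_ind (P : am_ring -> Prop) :
  (forall f, P (am_pi f)) -> forall q, P q.
Proof. by move=> h q; rewrite -[q]reprK; apply: h. Qed.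

Lemma am_repr f : am_equiv (repr (am_pi f)) f.
Proof.
suff /eqmodP : repr (am_pi f) = f %[mod am_ring] by [].
by rewrite reprK.
Qed.

Lemma am_dom_ideal f : two_sided_ideal (am_dom f).
Proof. by case: (am_domP f). Qed.

Lemma am_domD f x y : am_dom f x -> am_dom f y -> am_dom f (x + y).
Proof. by case: (am_dom_ideal f) => h _ _; exact: add_subgroupD. Qed.

Lemma am_domM f x a : am_dom f x -> am_dom f (x * a).
Proof. by case: (am_dom_ideal f) => _ _; apply. Qed.

Lemma am_fun0 f : f 0 = 0.
Proof.
have h : am_dom f 0 by case: (am_dom_ideal f) => -[].
by rewrite -[X in am_fun _ X](mulr0 0) am_funM // mulr0.
Qed.

Lemma am_funB f x y : am_dom f x -> am_dom f y -> f (x - y) = f x - f y.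
Proof.
move=> hx hy; have hN : am_dom f (- y).
  by case: (am_dom_ideal f) => h _ _; exact: add_subgroupN.
rewrite am_funD //; congr (_ + _); apply/eqP.
by rewrite -addr_eq0 -am_funD // addNr am_fun0.
Qed.

Lemma am_fun_mul f (J I : set U) x : J `<=` am_dom f ->
  two_sided_ideal J -> two_sided_ideal I ->
  ideal_mul J I x -> [/\ J x, I x & I (f x)].
Proof.
move=> Jf hJ hI hx; case: (ideal_mul_subI hJ hI hx) => Jx Ix; split=> //.
suff: (J `&` [set z | I (f z)]) x by case.
move: x hx {Jx Ix}; apply: ideal_mul_sub; last first.
  move=> x y Jx Iy; split; first by case: hJ => _ _; apply.
  by rewrite /= am_funM; [case: hI => _ + _; apply|apply: Jf].
have [[J0 JB] _ _] := hJ; have [[I0 IB] _ _] := hI.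
split; first by split=> //=; rewrite am_fun0.
move=> x y [Jx Ix] [Jy Iy]; split; first exact: JB.
by rewrite /= am_funB; [apply: IB|apply: Jf|apply: Jf].
Qed.

Lemma am_mul_dom f g x : ideal_mul (am_dom g) (am_dom f) x ->
  [/\ am_dom g x, am_dom f x & am_dom f (g x)].
Proof.
by move=> h; apply: (am_fun_mul (J := am_dom g)) => //; exact: am_dom_ideal.
Qed.

Definition am_hom_add f g : am_hom.
Proof.
refine (@AMHom (am_dom f `&` am_dom g) (fun x => f x + g x) _ _ _).
- by apply: null_lannI; exact: am_domP.
- by move=> x y [? ?] [? ?]; rewrite !am_funD // addrACA.
- by move=> x a [? ?]; rewrite !am_funM // mulrDl.
Defined.

Definition am_hom_opp f : am_hom.
Proof.
refine (@AMHom (am_dom f) (fun x => - f x) (am_domP f) _ _).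
- by move=> x y ? ?; rewrite am_funD // opprD.
- by move=> x a ?; rewrite am_funM // mulNr.
Defined.

(* The composite f \o g, on an ideal that g maps into the domain of f. *)
Definition am_hom_mul f g : am_hom.
Proof.
refine (@AMHom (ideal_mul (am_dom g) (am_dom f)) (fun x => f (g x)) _ _ _).
- by apply: null_lannM; exact: am_domP.
- by move=> x y /am_mul_dom[? _ ?] /am_mul_dom[? _ ?]; rewrite !am_funD.
- by move=> x a /am_mul_dom[? _ ?]; rewrite !am_funM.
Defined.

(* Left multiplication by u, a right-linear endomorphism of U. *)
Definition am_hom_lmul (u : U) : am_hom.
Proof.
refine (@AMHom setT (fun x => u * x) (@null_lannT U) _ _).
- by move=> x y _ _; rewrite mulrDr.
- by move=> x a _; rewrite mulrA.
Defined.

Definition am_add (p q : am_ring) := am_pi (am_hom_add (repr p) (repr q)).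
Definition am_opp (p : am_ring) := am_pi (am_hom_opp (repr p)).
Definition am_mul (p q : am_ring) := am_pi (am_hom_mul (repr p) (repr q)).

Definition am_embed (u : U) : am_ring := am_pi (am_hom_lmul u).

Lemma am_addE f g : am_add (am_pi f) (am_pi g) = am_pi (am_hom_add f g).
Proof.
apply: am_piP; case/asboolP: (am_repr f) => K [K1 K2 K3 K4].
case/asboolP: (am_repr g) => L [L1 L2 L3 L4].
apply/asboolP; exists (K `&` L); split=> /=.
- exact: null_lannI.
- by move=> x [/K2 ? /L2 ?].
- by move=> x [/K3 ? /L3 ?].
- by move=> x [/K4 -> /L4 ->].
Qed.

Lemma am_oppE f : am_opp (am_pi f) = am_pi (am_hom_opp f).
Proof.
apply: am_piP; case/asboolP: (am_repr f) => K [K1 K2 K3 K4].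
by apply/asboolP; exists K; split=> //= x /K4 ->.
Qed.

Lemma am_mulE f g : am_mul (am_pi f) (am_pi g) = am_pi (am_hom_mul f g).
Proof.
apply: am_piP; case/asboolP: (am_repr f) => K [K1 K2 K3 K4].
case/asboolP: (am_repr g) => L [L1 L2 L3 L4].
apply/asboolP; exists (ideal_mul L K); split=> /=.
- exact: null_lannM.
- exact: ideal_mulS.
- exact: ideal_mulS.
- move=> x hx; have [Lx Kx Kgx] := am_fun_mul L3 (proj1 L1) (proj1 K1) hx.
  by rewrite (L4 _ Lx) (K4 _ Kgx).
Qed.

Fact am_addA : associative am_add.
Proof.
elim/am_ind=> f; elim/am_ind=> g; elim/am_ind=> h; rewrite !am_addE.
by apply: am_piP; apply: am_equiv_on => x _ _ /=; rewrite addrA.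
Qed.
Fact am_addC : commutative am_add.
Proof.
elim/am_ind=> f; elim/am_ind=> g; rewrite !am_addE.
by apply: am_piP; apply: am_equiv_on => x _ _ /=; rewrite addrC.
Qed.
Fact am_add0 : left_id (am_embed 0) am_add.
Proof.
elim/am_ind=> f; rewrite am_addE.
by apply: am_piP; apply: am_equiv_on => x _ _ /=; rewrite mul0r add0r.
Qed.
Fact am_addN : left_inverse (am_embed 0) am_opp am_add.
Proof.
elim/am_ind=> f; rewrite am_oppE am_addE.
by apply: am_piP; apply: am_equiv_on => x _ _ /=; rewrite mul0r addNr.
Qed.
Fact am_mulA : associative am_mul.
Proof.
elim/am_ind=> f; elim/am_ind=> g; elim/am_ind=> h; rewrite !am_mulE.
by apply: am_piP; apply: am_equiv_on.
Qed.
Fact am_mul1l : left_id (am_embed 1) am_mul.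
Proof.
elim/am_ind=> f; rewrite am_mulE.
by apply: am_piP; apply: am_equiv_on => x _ _ /=; rewrite mul1r.
Qed.
Fact am_mul1r : right_id (am_embed 1) am_mul.
Proof.
elim/am_ind=> f; rewrite am_mulE.
by apply: am_piP; apply: am_equiv_on => x _ _ /=; rewrite mul1r.
Qed.
Fact am_mulDl : left_distributive am_mul am_add.
Proof.
elim/am_ind=> f; elim/am_ind=> g; elim/am_ind=> h; rewrite !(am_addE, am_mulE).
by apply: am_piP; apply: am_equiv_on.
Qed.
Fact am_mulDr : right_distributive am_mul am_add.
Proof.
elim/am_ind=> f; elim/am_ind=> g; elim/am_ind=> h; rewrite !(am_addE, am_mulE).
apply: am_piP; apply: am_equiv_on => x _ [] /= /am_mul_dom[_ _ ?].
by move=> /am_mul_dom[_ _ ?]; rewrite am_funD.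
Qed.

HB.instance Definition _ := GRing.isPzRing.Build am_ring
  am_addA am_addC am_add0 am_addN am_mulA am_mul1l am_mul1r am_mulDl am_mulDr.

Definition extended_centroid : set am_ring :=
  [set q : am_ring | forall p : am_ring, q * p = p * q].

End AmitsurMartindale.

Section Spectrum.
Variable U : pzRingType.

Record spec := Spec { spec_set :> set U; specP : prime_ideal spec_set }.
HB.instance Definition _ := gen_eqMixin spec.
HB.instance Definition _ := gen_choiceMixin spec.

Lemma spec_ideal (P : spec) : two_sided_ideal P.
Proof. by case: (specP P). Qed.

Definition zariski_V (I : set U) : set spec := [set P : spec | I `<=` P].

Definition zariski_open (O : set spec) := exists I : set U, ~` O = zariski_V I.

Fact zariski_openT : zariski_open setT.
Proof.
exists setT; rewrite setCT; apply/seteqP; split=> // P /= TP.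
have [_ /eqP nT _] := specP P; case: nT; apply/seteqP; split=> //.
Qed.

Fact zariski_openI : setI_closed zariski_open.
Proof.
move=> A B [I hI] [J hJ].
exists [set z | exists x y r, [/\ I x, J y & z = x * r * y]].
rewrite setCI hI hJ; apply/seteqP; split=> [P [h|h] _ [x [y [r [Ix Jy ->]]]]|P h].
- by case: (spec_ideal P) => _ Pl Pr; do 2!apply: (Pr); exact: h.
- by case: (spec_ideal P) => _ Pl Pr; apply: Pl; exact: h.
- apply: contrapT => /not_orP[/existsNP[x /not_implyP[Ix nx]]].
  move=> /existsNP[y /not_implyP[Jy ny]].
  have hxy r : spec_set P (x * r * y) by apply: h; exists x, y, r.
  by case: (prime_idealP (specP P) hxy).
Qed.

Fact zariski_open_bigU (T : Type) (f : T -> set spec) :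
  (forall i, zariski_open (f i)) -> zariski_open (\bigcup_i f i).
Proof.
move=> /choice[I hI]; exists (\bigcup_i I i).
rewrite setC_bigcup; apply/seteqP; split=> [P h x [i _ Ix]|P h i _].
  by have := h i Logic.I; rewrite hI; exact.
by rewrite hI => x Ix; apply: h; exists i.
Qed.

HB.instance Definition _ := isOpenTopological.Build spec
  zariski_openT zariski_openI zariski_open_bigU.

End Spectrum.

(* An affine algebraic group over an algebraically closed field k, in the
   classical sense: a group whose underlying set is (identified by coord with) a
   Zariski closed subset of k^n, such that multiplication and inversion are
   given by polynomials in the coordinates. *)
Record affine_group (k : closedFieldType) := AffineGroup {
  affine_sort :> groupType;
  affine_dim : nat;
  coord : affine_sort -> 'I_affine_dim -> k;
  coord_inj : injective coord;
  coord_closed : exists S : set {mpoly k[affine_dim]},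
    range coord = [set z | forall p, S p -> p.@[z] = 0];
  coord_mul : forall i, exists p : {mpoly k[affine_dim + affine_dim]},
    forall g h : affine_sort, coord (g * h)%g i =
      p.@[fun j => match fintype.split j with
                   | inl a => coord g a
                   | inr b => coord h b
                   end];
  coord_inv : forall i, exists p : {mpoly k[affine_dim]},
    forall g : affine_sort, coord (g^-1)%g i = p.@[coord g]
}.

Definition regular_fun (k : closedFieldType) (G : affine_group k) (f : G -> k) :=
  exists p : {mpoly k[affine_dim G]}, forall g, f g = p.@[coord g].

(* rho is a homomorphism of algebraic groups G -> GL_n. The first two clauses
   force rho g to be invertible; the last two say that rho is a morphism of
   varieties, k[GL_n] being generated by the matrix entries and 1 / det. *)
Definition alg_hom_GL (k : closedFieldType) (G : affine_group k) (n : nat)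
    (rho : G -> 'M[k]_n) :=
  [/\ rho 1%g = 1%:M,
      (forall g h, rho (g * h)%g = rho g *m rho h),
      (forall i j, regular_fun (fun g => rho g i j))
    & regular_fun (fun g => (\det (rho g))^-1)].

Record alg_action (k : closedFieldType) (G : groupType) (R : algType k) :=
  AlgAction {
    action_fun :> G -> {lrmorphism R -> R};
    action1 : forall x, action_fun 1%g x = x;
    actionM : forall g h x,
      action_fun (g * h)%g x = action_fun g (action_fun h x)
  }.

(* Every x lies in the span V of a linearly independent family v with respect
   to which G acts on V through a homomorphism of algebraic groups to GL_n
   (in particular V is G-stable). *)
Definition rational_action (k : closedFieldType) (G : affine_group k)
    (R : algType k) (a : alg_action G R) :=
  forall x : R, exists n (v : 'I_n -> R) (rho : G -> 'M[k]_n),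
    [/\ (forall c : 'I_n -> k, \sum_i c i *: v i = 0 -> forall i, c i = 0),
        (exists c : 'I_n -> k, x = \sum_i c i *: v i),
        alg_hom_GL rho
      & forall g j, a g (v j) = \sum_i rho g i j *: v i].

Section GSpectrum.
Variables (k : closedFieldType) (G : groupType) (R : algType k).
Variable a : alg_action G R.

Definition G_stable (I : set R) := forall g, a g @` I `<=` I.

Definition G_prime (I : set R) :=
  [/\ two_sided_ideal I, G_stable I, I != setT
    & forall A B, two_sided_ideal A -> G_stable A ->
        two_sided_ideal B -> G_stable B ->
        ideal_mul A B `<=` I -> A `<=` I \/ B `<=` I].

Record gspec := GSpec { gspec_set :> set R; gspecP : G_prime gspec_set }.
HB.instance Definition _ := gen_eqMixin gspec.
HB.instance Definition _ := gen_choiceMixin gspec.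

Definition G_core (P : set R) : set R := \bigcap_g (a g @` P).

Lemma actionK g : cancel (a g) (a g^-1%g).
Proof. by move=> x; rewrite -actionM mulVg action1. Qed.

Lemma actionVK g : cancel (a g^-1%g) (a g).
Proof. by move=> x; rewrite -actionM mulgV action1. Qed.

Lemma G_coreP (P : set R) x : G_core P x <-> forall g, P (a g x).
Proof.
split=> [h g|h g _].
  by have [y Py <-] := h g^-1%g Logic.I; rewrite actionVK.
by exists (a g^-1%g x); [exact: h|rewrite actionVK].
Qed.

Lemma G_core_prime (P : set R) : prime_ideal P -> G_prime (G_core P).
Proof.
move=> [[[P0 PB] Pl Pr] nT hP].
have sub : G_core P `<=` P by move=> x /G_coreP/(_ 1%g); rewrite action1.
have lift A : G_stable A -> A `<=` P -> A `<=` G_core P.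
  by move=> hA AP x Ax; apply/G_coreP => g; apply: AP; apply: hA; exists x.
split.
- split; first split.
  + by apply/G_coreP => g; rewrite raddf0.
  + move=> x y /G_coreP hx /G_coreP hy; apply/G_coreP => g.
    by rewrite raddfB; apply: PB; [exact: hx|exact: hy].
  + by move=> c x /G_coreP hx; apply/G_coreP => g; rewrite rmorphM; apply: Pl; exact: hx.
  + by move=> c x /G_coreP hx; apply/G_coreP => g; rewrite rmorphM; apply: Pr; exact: hx.
- by move=> g _ [x /G_coreP hx <-]; apply/G_coreP => h; rewrite -actionM.
- apply/eqP => hT; case/eqP: nT; apply/seteqP; split=> // x _.
  by apply: sub; rewrite hT.
- move=> A B hA sA hB sB hAB.
  have /(hP _ _ hA hB)[] : ideal_mul A B `<=` P by move=> x /hAB/sub.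
    by move=> ?; left; exact: lift.
  by move=> ?; right; exact: lift.
Qed.

Definition gamma (P : spec R) : gspec := GSpec (G_core_prime (specP P)).

Definition gspec_open (O : set gspec) := open (gamma @^-1` O).

Fact gspec_openT : gspec_open setT.
Proof. by rewrite /gspec_open preimage_setT; exact: openT. Qed.

Fact gspec_openI : setI_closed gspec_open.
Proof. by move=> A B hA hB; exact: (openI hA hB). Qed.

Fact gspec_open_bigU (T : Type) (f : T -> set gspec) :
  (forall i, gspec_open (f i)) -> gspec_open (\bigcup_i f i).
Proof.
by move=> h; rewrite /gspec_open preimage_bigcup; apply: bigcup_open => i _; exact: h.
Qed.

HB.instance Definition _ := isOpenTopological.Build gspec
  gspec_openT gspec_openI gspec_open_bigU.

End GSpectrum.

(* C(R/P) = k means that the canonical map k -> C(R/P) is bijective. *)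
Definition rational_prime (k : closedFieldType) (R : algType k) (P : spec R) :=
  set_bij [set: k] (@extended_centroid (quo_ring (spec_ideal P)))
    (fun c : k => am_embed (quo_pi (spec_ideal P) c%:A)).

Definition locally_closed_point (T : topologicalType) (x : T) :=
  exists O : set T, open O /\ O `&` closure [set x] = [set x].

(* Main.v *)
(* Let I = P:G. For X contained in G, write P:X for the set of r with g.r in P
   for all g in X. The group G is a finite union of irreducible subsets X (Hilbert's
   basis theorem), and then each P:X is prime and the intersection of these
   primes is I. By prime avoidance it is enough to argue with each X in turn,
   provided that the final comparison is made at a minimal P:X.

   (b) => (a): if Q is a prime strictly containing P, then Q:X strictly contains
   P:X. Indeed, in an expression f_1(g) g.r_1 + ... + f_n(g) g.r_n of minimal
   length with values in Q but not all in P, rationality of P makes the value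
   proportional to g.r_1 modulo P wherever the latter is nonzero, so that
   g.r_1 lies in Q for g in a nonempty open subset of X, hence on X. So
   Q:G <> I, and Q contains an element not in P given by (b).

   (a) => (b): the ring F of regular maps X -> R/P is prime, and it is generated
   by the image of R under r |-> (g |-> g.r) together with the coordinate functions
   on X, which are central. A noncommutative version of Chevalley's theorem on
   constructible sets (prime_lift) provides, for each nonzero d in F, some e in R
   outside P:X such that every prime Q of R containing P:X but not e is contained
   in a prime M' of F with d not in M'. Choose for d a constant in all primes
   strictly above P; then the constants of M' form the prime P / P. As the
   G-stable ideal Q:G generates in F an ideal containing its own constants, Q:G is
   contained in P. Hence e lies in every prime Q over P:X with Q:G <> I. *)

Require Import Defs.
From HB Require Import structures.
From mathcomp Require Import all_boot all_order all_algebra.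
From mathcomp Require Import all_classical.
From mathcomp Require Import topology_structure.
From mathcomp Require Import mpoly zify.

Set Implicit Arguments.
Unset Strict Implicit.
Unset Printing Implicit Defensive.

Import Order.TTheory GRing.Theory.
Local Open Scope classical_set_scope.
Local Open Scope ring_scope.

(** * Maximal sets above a given set *)

Lemma Zorn_above (T : Type) (good : set T -> Prop) (M0 : set T) : good M0 ->
  (forall F : set (set T), F !=set0 -> F `<=` good ->
     (forall M, F M -> M0 `<=` M) -> total_on F subset ->
     good (\bigcup_(M in F) M)) ->
  exists M, [/\ good M, M0 `<=` M
    & forall M', good M' -> M `<=` M' -> M' `<=` M].
Proof.
move=> g0 gU.
have [F FP tF|M [gM maxM]] := @Zorn_bigcup T [set M | good (M0 `|` M)].
- have [->|/set0P F0] := eqVneq F set0; first by rewrite /= bigcup_set0 setU0.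
  rewrite /=.
  have -> : M0 `|` \bigcup_(i in F) i =
            \bigcup_(M in [set M0 `|` i | i in F]) M.
    rewrite bigcup_image; apply/seteqP; split=> x.
      by case=> [M0x|[N FN Nx]]; [case: F0 => N FN; exists N => //; left
                                 |exists N => //; right].
    by case=> N FN [M0x|Nx]; [left|right; exists N].
  apply: gU.
  + by case: F0 => N FN; exists (M0 `|` N), N.
  + by move=> _ [N FN <-]; apply: FP.
  + by move=> _ [N FN <-] x; left.
  + move=> _ _ [N FN <-] [N' FN' <-].
    by case: (tF _ _ FN FN') => h; [left|right]; apply: setUS.
- exists (M0 `|` M); split=> // M' gM' sM'.
  have e : M0 `|` M' = M' by apply/setUidPr => x ?; apply: sM'; left.
  apply: contrapT => nsub; apply: (maxM M'); last by rewrite /= e.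
  split; last by move=> h; apply: nsub => x /h; right.
  by move=> x ?; apply: sM'; right.
Qed.

(** * Finite covers by irreducible sets *)

(** By induction on [n]. A basis [B] for the first [n] exponents also serves every [x] whose last
    exponent is at least the maximum [m] of that exponent on [B]; each of the finitely many slices
    below [m] gets its own basis. *)
Lemma dickson (T : eqType) (f : T -> nat -> nat) n (S : set T) :
  exists B : seq T, (forall b, b \in B -> S b) /\
    forall x, S x -> exists2 b, b \in B & forall i, (i < n)%N -> (f b i <= f x i)%N.
Proof.
elim: n S => [|n IH] S.
  have [[x Sx]|nS] := pselect (exists x, S x).
    exists [:: x]; split=> [b|y _]; first by rewrite inE => /eqP ->.
    by exists x => //; rewrite inE.
  by exists [::]; split=> // x Sx; case: nS; exists x.
have [B [SB hB]] := IH S.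
have /choice[C hC] : forall j, exists B : seq T,
    (forall b, b \in B -> S b /\ f b n = j) /\
    forall x, S x -> f x n = j ->
      exists2 b, b \in B & forall i, (i < n)%N -> (f b i <= f x i)%N.
  move=> j; have [Bj [SBj hBj]] := IH [set x | S x /\ f x n = j].
  by exists Bj; split=> // x Sx xj; apply: hBj.
pose m := \max_(b <- B) f b n.
exists (B ++ flatten [seq C j | j <- iota 0 m]); split=> [b|x Sx].
  rewrite mem_cat => /orP[/SB //|/flattenP[_ /mapP[j _ ->]]].
  by have [h _] := hC j => /h[].
have [lt|le] := ltnP (f x n) m.
  have [hCn hCx] := hC (f x n); have [//|//|b bC hb] := hCx x.
  exists b; first by rewrite mem_cat; apply/orP; right; apply/flattenP;
    exists (C (f x n)) => //; apply: map_f; rewrite mem_iota.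
  move=> i; rewrite ltnS leq_eqVlt => /predU1P[->|/hb //].
  by have [_ ->] := hCn _ bC.
have [b bB hb] := hB x Sx; exists b; first by rewrite mem_cat bB.
move=> i; rewrite ltnS leq_eqVlt => /predU1P[->|/hb //].
by apply: leq_trans le; apply: (@leq_bigmax_seq _ _ xpredT (fun b => f b n)).
Qed.

Section Noetherian.
Variables (k : fieldType) (n : nat).
Implicit Types (J : set {mpoly k[n]}) (p q : {mpoly k[n]}) (z : 'I_n -> k).

(* Hilbert's basis theorem, for zero sets: Dickson's lemma applied to the
   leading monomials of J. *)
Lemma zero_set_basis J : add_subgroup J -> (forall q p, J p -> J (q * p)) ->
  exists B : seq {mpoly k[n]}, (forall b, b \in B -> J b) /\
    forall z, (forall b, b \in B -> b.@[z] = 0) -> forall p, J p -> p.@[z] = 0.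
Proof.
move=> [J0 JB] Jl.
pose f p i := if insub i is Some i' then mlead p (i' : 'I_n) else 0%N.
have [B [JBp hB]] := dickson f n [set p | J p /\ p != 0].
exists B; split=> [b /JBp[]//|z hz]; elim/mleadrect => p IH Jp.
have [->|p0] := eqVneq p 0; first by rewrite meval0.
have [b bB hb] := hB p (conj Jp p0); have [Jb b0] := JBp _ bB.
have le : (mlead b <= mlead p)%MM.
  apply/mnm_lepP => i; have := hb i (ltn_ord i).
  by rewrite /f valK.
have lb0 : mleadc b != 0 by rewrite mleadc_eq0.
pose q := (mleadc p / mleadc b) *: 'X_[(mlead p - mlead b)] * b.
have eq0 : q.@[z] = 0 by rewrite mevalM (hz b bB) mulr0.
have qlead : mlead q = mlead p.
  rewrite /q -scalerAl mleadZ ?mulf_neq0 ?invr_neq0 ?mleadc_eq0 //.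
  by rewrite mleadM // ?mleadXm ?submK // -mleadc_eq0 mleadXm mcoeffX eqxx oner_neq0.
have qc : mleadc q = mleadc p.
  have := mleadcM 'X_[(mlead p - mlead b)] b.
  rewrite mleadXm submK // mcoeffX eqxx mul1r => e.
  by rewrite qlead /q -scalerAl mcoeffZ e divfK.
suff : (p - q).@[z] = 0 by rewrite mevalB eq0 subr0.
have [->|pq0] := eqVneq (p - q) 0; first by rewrite meval0.
apply: IH; last by apply: JB => //; apply: Jl.
have le' : (mlead (p - q) <= mlead p)%O.
  by apply: le_trans (mleadB_le _ _) _; rewrite qlead leUx lexx.
rewrite lt_neqAle le' andbT; apply: contraNneq pq0 => e.
by rewrite -mleadc_eq0 e mcoeffB -{2}qlead qc subrr.
Qed.

End Noetherian.

Section Cover.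
Variables (k : closedFieldType) (G : affine_group k).

Definition irreducible_set (X : set G) := X !=set0 /\
  forall p q : G -> k, regular_fun p -> regular_fun q ->
    (forall g, X g -> p g * q g = 0) ->
    (forall g, X g -> p g = 0) \/ (forall g, X g -> q g = 0).

Let zeros (J : set {mpoly k[affine_dim G]}) : set G :=
  [set g | forall p, J p -> p.@[Defs.coord g] = 0].

Let covered (Y : set G) := exists s : seq (set G),
  (forall X, X \in s -> irreducible_set X) /\ forall g, Y g -> exists2 X, X \in s & X g.

(** Noetherian induction: if [J] is maximal among the ideals whose zero set has no finite cover,
    that zero set is nonempty and reducible, and two regular functions split it into smaller closed
    sets, both covered. *)
Lemma irreducible_cover : exists s : seq (set G),
  (forall X, X \in s -> irreducible_set X) /\ forall g, exists2 X, X \in s & X g.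
Proof.
suff [s [hs cs]] : covered (zeros [set 0]).
  by exists s; split=> // g; apply: cs => p ->; rewrite meval0.
apply: contrapT => bad0.
pose good (J : set {mpoly k[affine_dim G]}) := [/\ add_subgroup J,
  (forall q p, J p -> J (q * p)) & ~ covered (zeros J)].
have [||J [[hJ Jl badJ] _ maxJ]] := @Zorn_above _ good [set 0].
- split=> //; first by split=> // p q -> ->; rewrite /= subrr.
  by move=> q p ->; rewrite /= mulr0.
- move=> F [N0 FN0] Fg _ tF.
  have hU : add_subgroup (\bigcup_(M in F) M).
    split; first by exists N0 => //; have [[]] := Fg _ FN0.
    move=> x y [N FN Nx] [N' FN' N'y]; have [sub|sub] := tF _ _ FN FN'.
      by exists N' => //; have [[_ NB] _ _] := Fg _ FN'; apply: NB => //; apply: sub.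
    by exists N => //; have [[_ NB] _ _] := Fg _ FN; apply: NB => //; apply: sub.
  have Ul q p : (\bigcup_(M in F) M) p -> (\bigcup_(M in F) M) (q * p).
    by case=> N FN Np; exists N => //; have [_ h _] := Fg _ FN; apply: h.
  (* The zero set of the union is cut out by finitely many of its members, and these already lie in
     one ideal of the chain. *)
  split=> // cov; have [B [BU hB]] := zero_set_basis hU Ul.
  have [N FN BN] : exists2 N, F N & forall b, b \in B -> N b.
    elim: B BU {hB} => [|b B IH] BU; first by exists N0.
    have [|N FN BN] := IH; first by move=> c cB; apply: BU; rewrite inE cB orbT.
    have [|N' FN' N'b] := BU b; first by rewrite inE eqxx.
    have [sub|sub] := tF _ _ FN FN'; [exists N'|exists N] => // c;
      rewrite inE => /predU1P[->|cB] //; do ?[exact: BN | exact: sub].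
    by apply: sub; apply: BN.
  have [_ _ []] := Fg _ FN; have [s [hs cs]] := cov; exists s; split=> // g hg.
  by apply: cs => p Up; apply: hB Up => b /BN; apply: hg.
(* If this locus had no finite cover, its ideal [J'], which contains [J], would be good; maximality
   would put the polynomial of [h] into [J]. *)
have ext h : regular_fun h -> ~ (forall g, zeros J g -> h g = 0) ->
    covered (zeros J `&` [set g | h g = 0]).
  move=> [p hp] nh.
  pose J' := [set q : {mpoly k[affine_dim G]} |
    forall g, zeros J g -> h g = 0 -> q.@[Defs.coord g] = 0].
  apply: contrapT => bad; apply: nh => g hg; rewrite hp; apply: (hg).
  apply: (maxJ J'); last by move=> g'; rewrite -hp.
    split.
    + split=> [g' _ _|q r hq hr g' h1 h2]; first by rewrite meval0.
      by rewrite mevalB hq // hr // subrr.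
    + by move=> r q hq g' h1 h2; rewrite mevalM hq // mulr0.
    + move=> [s [hs cs]]; apply: bad; exists s; split=> // g' [h1 h2].
      by apply: cs => q; apply.
  by move=> q Jq g' h1 _; apply: h1.
apply: badJ; have [irr|nirr] := pselect (irreducible_set (zeros J)).
  exists [:: zeros J]; split=> [X|g hg]; first by rewrite inE => /eqP ->.
  by exists (zeros J) => //; rewrite inE.
have [[g0 Zg0]|ne] := pselect (zeros J !=set0); last first.
  by exists [::]; split=> // g hg; case: ne; exists g.
have [p [q [hp hq pq np nq]]] : exists p q : G -> k, [/\ regular_fun p, regular_fun q,
    (forall g, zeros J g -> p g * q g = 0), ~ (forall g, zeros J g -> p g = 0)
    & ~ (forall g, zeros J g -> q g = 0)].
  apply: contrapT => none; apply: nirr; split; first by exists g0.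
  move=> p q hp hq pq; apply: contrapT => /not_orP[np nq]; apply: none.
  by exists p, q.
have [s [hs cs]] := ext p hp np; have [t [ht ct]] := ext q hq nq.
exists (s ++ t); split=> [X|g hg].
  by rewrite mem_cat => /orP[/hs|/ht].
have /eqP := pq g hg; rewrite mulf_eq0 => /orP[/eqP e|/eqP e].
  by have [X Xs Xg] := cs g (conj hg e); exists X; rewrite ?mem_cat ?Xs.
by have [X Xs Xg] := ct g (conj hg e); exists X; rewrite ?mem_cat ?Xs ?orbT.
Qed.

End Cover.
(** * Rational primes *)

Section CentralMap.
Variables (U : pzRingType) (a b : U).
Hypothesis primeU : forall x y : U, (forall t, x * t * y = 0) -> x = 0 \/ y = 0.
Hypothesis a0 : a <> 0.
Hypothesis ab : forall t, a * t * b = b * t * a.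

(* The map w a t |-> w b t of the ideal U a U, extended to the largest ideal on
   which its values are determined. *)
Let central_rel (x w : U) := forall y, w * y * a = x * y * b.
Let central_dom : set U := [set x | exists w, central_rel x w].
Let central_fun (x : U) : U := xget 0 [set w | central_rel x w].

Let central_funP x : central_dom x -> central_rel x (central_fun x).
Proof. by move=> h; apply: (xgetPex 0 h). Qed.

Let central_fun_eq x w : central_rel x w -> central_fun x = w.
Proof.
move=> h; have hx : central_dom x by exists w.
have [t|/eqP|//] := @primeU (central_fun x - w) a.
  by rewrite !mulrBl (central_funP hx) h subrr.
by rewrite subr_eq0 => /eqP.
Qed.

Let central_relD x y v w :
  central_rel x v -> central_rel y w -> central_rel (x + y) (v + w).
Proof. by move=> hx hy t; rewrite !mulrDl hx hy. Qed.

Let central_relMl c x w : central_rel x w -> central_rel (c * x) (c * w).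
Proof. by move=> h t; rewrite -!mulrA (mulrA w) h !mulrA. Qed.

Let central_relMr c x w : central_rel x w -> central_rel (x * c) (w * c).
Proof. by move=> h t; rewrite -(mulrA w) h !mulrA. Qed.

Let central_ideal : two_sided_ideal central_dom.
Proof.
split; first split.
- by exists 0 => y; rewrite !mul0r.
- move=> x y [v hv] [w hw]; exists (v - w) => t.
  by rewrite !mulrBl hv hw.
- by move=> c x [w hw]; exists (c * w); apply: central_relMl.
- by move=> c x [w hw]; exists (w * c); apply: central_relMr.
Qed.

Let central_null_lann : null_lann_ideal central_dom.
Proof.
split=> // u hu; have [t||//] := @primeU u a; last by [].
rewrite -mulrA; apply: hu; have [_ Il _] := central_ideal; apply: Il.
by exists b => y; rewrite ab.
Qed.

Definition central_hom : am_hom U.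
Proof.
refine (@AMHom U central_dom central_fun central_null_lann _ _).
- move=> x y hx hy; apply: central_fun_eq.
  by apply: central_relD; apply: central_funP.
- by move=> x c hx; apply: central_fun_eq; apply: central_relMr; apply: central_funP.
Defined.

Lemma central_hom_at : am_dom central_hom a /\ central_hom a = b.
Proof.
have h : central_rel a b by move=> y; rewrite ab.
by split; [exists b|apply: central_fun_eq].
Qed.

(** The map is left linear as well as right linear on its domain. Hence at a product [y * w] of
    elements of [J] both composites with [f] equal [f y * central_fun w]. *)
Lemma central_hom_central : extended_centroid (am_pi central_hom).
Proof.
elim/am_ind => f; rewrite -[LHS]/(am_mul _ _) -[RHS]/(am_mul _ _) !am_mulE.
apply: am_piP; set J := am_dom f `&` central_dom.
have nJ : null_lann_ideal J by apply: null_lannI => //; apply: am_domP.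
have [hJ _] := nJ.
apply/asboolP; exists (ideal_mul J J); split.
- exact: null_lannM.
- by apply: ideal_mulS => x [].
- by apply: ideal_mulS => x [].
move=> x hx.
suff: [set x | ideal_mul J J x /\ central_fun (f x) = f (central_fun x)] x by case.
have dom y : ideal_mul J J y -> [/\ am_dom f y, central_dom y,
    central_dom (f y) & am_dom f (central_fun y)].
  move=> hy; have h1 : ideal_mul (am_dom f) (am_dom central_hom) y.
    by apply: ideal_mulS hy => z [].
  have h2 : ideal_mul (am_dom central_hom) (am_dom f) y.
    by apply: ideal_mulS hy => z [].
  have [? ? ?] := am_mul_dom h1.
  have [_ _ ?] := am_mul_dom h2.
  by split.
have c0 : central_fun 0 = 0 := am_fun0 central_hom.
have cB y z : central_dom y -> central_dom z ->
    central_fun (y - z) = central_fun y - central_fun z.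
  exact: (@am_funB _ central_hom).
move: x hx; apply: ideal_mul_sub.
  have [M0 MB] := add_subgroup_ideal_mul J J.
  split; first by split=> //=; rewrite am_fun0 c0 am_fun0.
  move=> x y [hx ex] [hy ey]; split; first exact: MB.
  have [fx cx cfx fcx] := dom _ hx; have [fy cy cfy fcy] := dom _ hy.
  by rewrite /= am_funB // cB // ex ey cB // am_funB.
move=> y w [fy cy] [fw cw]; split; first exact: ideal_mul_gen.
have eMl c z : central_dom z -> central_fun (c * z) = c * central_fun z.
  by move=> hz; apply: central_fun_eq; apply: central_relMl; apply: central_funP.
by rewrite am_funM // !eMl // am_funM.
Qed.

End CentralMap.

Lemma quo_pi_eq0 (U : pzRingType) (I : set U) (hI : two_sided_ideal I) x :
  quo_pi hI x = 0 <-> I x.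
Proof.
have -> : (0 : quo_ring hI) = quo_pi hI 0 by [].
by split=> [/eqP/quo_piP|h]; [|apply/eqP/quo_piP]; rewrite subr0.
Qed.

Lemma quo_piD (U : pzRingType) (I : set U) (hI : two_sided_ideal I) x y :
  quo_pi hI (x + y) = quo_pi hI x + quo_pi hI y.
Proof. by rewrite -quo_addE. Qed.

Lemma quo_piB (U : pzRingType) (I : set U) (hI : two_sided_ideal I) x y :
  quo_pi hI (x - y) = quo_pi hI x - quo_pi hI y.
Proof. by rewrite quo_piD -quo_oppE. Qed.

Lemma quo_piM (U : pzRingType) (I : set U) (hI : two_sided_ideal I) x y :
  quo_pi hI (x * y) = quo_pi hI x * quo_pi hI y.
Proof. by rewrite -quo_mulE. Qed.

Lemma quo_prime (U : pzRingType) (P : spec U) (x y : quo_ring (spec_ideal P)) :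
  (forall t, x * t * y = 0) -> x = 0 \/ y = 0.
Proof.
elim/quo_ind: x => x; elim/quo_ind: y => y h.
have [r|Px|Py] := @prime_idealP _ P x y (specP P); first 1 last.
- by left; apply/quo_pi_eq0.
- by right; apply/quo_pi_eq0.
by apply/(quo_pi_eq0 (spec_ideal P)); rewrite !quo_piM.
Qed.

(** Modulo [P], the hypothesis yields an element of the extended centroid sending [a] to [b], and
    rationality makes it a scalar. *)
Lemma rational_proportional (k : closedFieldType) (R : algType k) (P : spec R)
    (a b : R) : rational_prime P -> ~ spec_set P a ->
  (forall t, spec_set P (a * t * b - b * t * a)) ->
  exists c : k, spec_set P (b - c *: a).
Proof.
move=> [_ _ surj] Pa hab; pose pi := quo_pi (spec_ideal P).
have a0 : pi a <> 0 by move/quo_pi_eq0.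
have ab t : pi a * t * pi b = pi b * t * pi a.
  elim/quo_ind: t => t; apply/eqP; rewrite -subr_eq0.
  have := hab t; rewrite -(quo_pi_eq0 (spec_ideal P)) quo_piB !quo_piM => ->.
  by [].
have [da ea] := central_hom_at (@quo_prime _ P) a0 ab.
have [c _ /eqmodP/asboolP[K [[hK nK] _ Kd eK]]] :=
  surj _ (central_hom_central (@quo_prime _ P) a0 ab).
exists c; apply/(quo_pi_eq0 (spec_ideal P)); apply: nK => x Kx.
(* The two maps are known to agree on [K], so they are compared at [pi a * x] for [x] in [K]; the
   zero left annihilator of [K] removes [x]. *)
have [_ Kl _] := hK; have := eK _ (Kl (pi a) _ Kx).
rewrite (@am_funM _ (central_hom _ a0 ab)) // ea /= => e.
by rewrite quo_piB mulrBl -e -(mulr_algl c a) quo_piM mulrA subrr.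
Qed.
(** * Lifting primes to finitely generated central extensions *)

Section SubringPrimes.
Variable W : nzRingType.
Implicit Types (T M : set W) (p q f g : {poly W}).

(** Subrings and their ideals are sets in one ambient ring, so that a tower of extensions stays in a
    single type. *)
Definition subring_set T :=
  [/\ T 1, forall x y, T x -> T y -> T (x - y)
    & forall x y, T x -> T y -> T (x * y)].

Definition ideal_in T M :=
  [/\ M `<=` T, add_subgroup M, (forall t x, T t -> M x -> M (t * x))
    & (forall t x, T t -> M x -> M (x * t))].

Definition prime_in T M :=
  [/\ ideal_in T M, ~ M 1
    & forall x y, T x -> T y -> (forall s, T s -> M (x * s * y)) -> M x \/ M y].

Definition poly_over T : set {poly W} := [set p | forall i, T p`_i].

Definition adjoin T (a : W) : set W := [set p.[a] | p in poly_over T].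

Lemma add_subgroup_subring T : subring_set T -> add_subgroup T.
Proof. by case=> T1 TB _; split=> //; rewrite -(subrr 1); apply: TB. Qed.

Lemma add_subgroup_sum T (I : Type) (r : seq I) (P : pred I) (F : I -> W) :
  add_subgroup T -> (forall i, P i -> T (F i)) -> T (\sum_(i <- r | P i) F i).
Proof.
by move=> hT h; elim/big_ind: _ => //; [case: hT|move=> *; apply: add_subgroupD].
Qed.

Lemma poly_overB T p q : add_subgroup T ->
  poly_over T p -> poly_over T q -> poly_over T (p - q).
Proof. by move=> [_ TB] hp hq i; rewrite coefB; apply: TB. Qed.

Lemma poly_overC T c : add_subgroup T -> T c -> poly_over T c%:P.
Proof. by move=> [T0 _] Tc i; rewrite coefC; case: ifP. Qed.

Lemma poly_overMXn T p n : add_subgroup T ->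
  poly_over T p -> poly_over T (p * 'X^n).
Proof. by move=> [T0 _] hp i; rewrite coefMXn; case: ifP. Qed.

Lemma poly_overMl T M p q : ideal_in T M ->
  poly_over T p -> poly_over M q -> poly_over M (p * q).
Proof.
move=> [_ hM Ml _] hp hq i; rewrite coefM.
by apply: add_subgroup_sum => // j _; apply: Ml.
Qed.

Lemma poly_overMr T M p q : ideal_in T M ->
  poly_over M p -> poly_over T q -> poly_over M (p * q).
Proof.
move=> [_ hM _ Mr] hp hq i; rewrite coefM.
by apply: add_subgroup_sum => // j _; apply: Mr.
Qed.

Lemma ideal_in_self T : subring_set T -> ideal_in T T.
Proof.
move=> hT; have hA := add_subgroup_subring hT; case: hT => _ _ TM.
by split=> // t x ? ?; apply: TM.
Qed.

Lemma poly_overM T p q : subring_set T ->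
  poly_over T p -> poly_over T q -> poly_over T (p * q).
Proof. by move=> hT; apply: poly_overMl; apply: ideal_in_self. Qed.

(* One step of the pseudo-division of p by f; the element s is inserted
   because T need not be commutative. *)
Definition pseudo_red f (s : W) p :=
  (lead_coef f * s)%:P * p - f * (s * lead_coef p)%:P * 'X^(size p - size f).

Lemma size_pseudo_red f s p :
  (0 < size f <= size p)%N -> (size (pseudo_red f s p) < size p)%N.
Proof.
move=> /andP[f0 fp]; have p0 := leq_trans f0 fp.
rewrite -(prednK p0) ltnS; apply/leq_sizeP => j hj.
rewrite /pseudo_red coefB coefCM coefMXn coefMC.
have -> : (j < size p - size f)%N = false by lia.
have [e|ne] := eqVneq j (size p).-1.
  have -> : (j - (size p - size f))%N = (size f).-1 by lia.
  by rewrite e -!lead_coefE mulrA subrr.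
have lt : (size p <= j)%N by lia.
rewrite (nth_default _ lt).
have lt2 : (size f <= j - (size p - size f))%N by lia.
by rewrite (nth_default _ lt2) mulr0 mul0r subr0.
Qed.

Lemma poly_over_pseudo_red T f s p : subring_set T ->
  poly_over T f -> T s -> poly_over T p -> poly_over T (pseudo_red f s p).
Proof.
move=> hT Tf Ts Tp; have hA := add_subgroup_subring hT; have [_ _ TM] := hT.
have Tlf : T (lead_coef f) by apply: Tf.
have Tlp : T (lead_coef p) by apply: Tp.
apply: poly_overB => //.
  by apply: poly_overM => //; apply: poly_overC => //; apply: TM.
apply: poly_overMXn => //.
by apply: poly_overM => //; apply: poly_overC => //; apply: TM.
Qed.

Definition ideal_gen T (A : set W) : set W :=
  [set z | forall N, ideal_in T N -> A `<=` N -> N z].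

Lemma ideal_in_gen T A : subring_set T -> A `<=` T -> ideal_in T (ideal_gen T A).
Proof.
move=> hT AT; split.
- by move=> z; apply => //; apply: ideal_in_self.
- split=> [N [_ [N0 _]] //|x y hx hy N hN AN]; have [_ [_ NB] _ _] := hN.
  by apply: NB; [apply: hx|apply: hy].
- by move=> t x Tt hx N hN AN; have [_ _ Nl _] := hN; apply: Nl => //; apply: hx.
- by move=> t x Tt hx N hN AN; have [_ _ _ Nr] := hN; apply: Nr => //; apply: hx.
Qed.

Lemma ideal_gen_annihil T M A (y : W) : subring_set T -> ideal_in T M -> A `<=` T ->
  (forall x s, A x -> T s -> M (x * s * y)) ->
  forall z s, ideal_gen T A z -> T s -> M (z * s * y).
Proof.
move=> hT [_ [M0 MB] Ml _] AT h z s hz; have [T1 TB TM] := hT.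
have [_ TA] := add_subgroup_subring hT.
suff: [set z | T z /\ forall s, T s -> M (z * s * y)] z by case=> _; apply.
apply: hz; last by move=> x Ax; split=> [|t Tt]; [apply: AT|apply: h].
split; first by move=> x [].
- split; first by split=> [|t _]; rewrite ?mul0r //; case: (add_subgroup_subring hT).
  move=> u v [Tu hu] [Tv hv]; split; first exact: TB.
  by move=> t Tt; rewrite !mulrBl; apply: MB; [apply: hu|apply: hv].
- move=> t x Tt [Tx hx]; split; first exact: TM.
  by move=> r Tr; rewrite -!mulrA; apply: Ml => //; rewrite mulrA; apply: hx.
- move=> t x Tt [Tx hx]; split; first exact: TM.
  by move=> r Tr; rewrite -(mulrA x); apply: hx; apply: TM.
Qed.

Lemma ideal_gen_annihilr T M A (x : W) : subring_set T -> ideal_in T M -> A `<=` T ->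
  (forall y s, A y -> T s -> M (x * s * y)) ->
  forall z s, ideal_gen T A z -> T s -> M (x * s * z).
Proof.
move=> hT [_ [M0 MB] _ Mr] AT h z s hz; have [T1 TB TM] := hT.
suff: [set z | T z /\ forall s, T s -> M (x * s * z)] z by case=> _; apply.
apply: hz; last by move=> u Au; split=> [|t Tt]; [apply: AT|apply: h].
split; first by move=> u [].
- split; first by split=> [|t _]; rewrite ?mulr0 //; case: (add_subgroup_subring hT).
  move=> u v [Tu hu] [Tv hv]; split; first exact: TB.
  by move=> t Tt; rewrite !mulrBr; apply: MB; [apply: hu|apply: hv].
- move=> t u Tt [Tu hu]; split; first exact: TM.
  by move=> r Tr; rewrite mulrA -(mulrA x); apply: hu; apply: TM.
- move=> t u Tt [Tu hu]; split; first exact: TM.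
  by move=> r Tr; rewrite mulrA; apply: Mr => //; apply: hu.
Qed.

(* An ideal of S maximal among those meeting the subring T inside its prime M. *)
Lemma prime_lying_over S T M M0 : subring_set S -> T `<=` S -> subring_set T ->
  prime_in T M -> ideal_in S M0 -> (forall x, T x -> M0 x -> M x) ->
  exists M', [/\ prime_in S M', M0 `<=` M' & forall x, T x -> M' x -> M x].
Proof.
move=> hS TS [T1 _ TM] [[MT hM Ml Mr] M1 hP] hM0 M0T; have [S1 SB SM] := hS.
pose good N := ideal_in S N /\ forall x, T x -> N x -> M x.
have [//|F [N0 FN0] Fg FM0 tF|M' [[hI M'T] sM' mM']] := @Zorn_above W good M0.
  split; last by move=> x Tx [N /Fg[_ h] Nx]; apply: h.
  split; first by move=> x [N /Fg[[h _ _ _] _]]; apply: h.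
  - split=> [|x y [N FN Nx] [N' FN' N'y]].
      by exists N0 => //; have [[_ [? _] _ _] _] := Fg _ FN0.
    have [sub|sub] := tF _ _ FN FN'.
      exists N' => //; have [[_ [_ NB] _ _] _] := Fg _ FN'.
      by apply: NB => //; apply: sub.
    exists N => //; have [[_ [_ NB] _ _] _] := Fg _ FN.
    by apply: NB => //; apply: sub.
  - by move=> t x St [N FN Nx]; exists N => //; have [[_ _ h _] _] := Fg _ FN; apply: h.
  - by move=> t x St [N FN Nx]; exists N => //; have [[_ _ _ h] _] := Fg _ FN; apply: h.
exists M'; split=> //; split=> //; first by move=> h; apply: M1; apply: M'T.
move=> x y Sx Sy hxy; have [M'S hM' M'l M'r] := hI.
(* By maximality, enlarging [M'] by [z] produces an element of [T] outside [M]. Doing so for both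
   [x] and [y] contradicts the primality of [M]. *)
have grow z : S z -> ~ M' z ->
    exists t, [/\ T t, ~ M t & ideal_gen S (M' `|` [set z]) t].
  move=> Sz nz; apply: contrapT => none; apply: nz.
  apply: (mM' (ideal_gen S (M' `|` [set z]))).
  - split; first by apply: ideal_in_gen => // u [/M'S|->].
    by move=> u Tu hu; apply: contrapT => nu; apply: none; exists u.
  - by move=> u hu N hN sN; apply: sN; left.
  - by move=> N hN sN; apply: sN; right.
apply: contrapT => /not_orP[/(grow _ Sx)[t [Tt nt ht]] /(grow _ Sy)[u [Tu nu hu]]].
case: (hP t u) => // s Ts; have Ss := TS _ Ts.
apply: M'T; first by do 2!apply: (TM) => //.
have AS z : S z -> M' `|` [set z] `<=` S by move=> Sz w [/M'S|->].
apply: (ideal_gen_annihilr hS hI (AS _ Sy)) => // w r [M'w|->] Sr.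
  by apply: M'l => //; apply: SM => //; apply: TS.
apply: (ideal_gen_annihil hS hI (AS _ Sx)) => // v q [M'v|->] Sq; last exact: hxy.
by do 2!apply: (M'r) => //.
Qed.

(** * Adjoining one central element *)

Section Step.
Variables (T : set W) (a : W).
Hypothesis hT : subring_set T.
Hypothesis aC : forall w, a * w = w * a.

Local Notation T' := (adjoin T a).

Let hA : add_subgroup T. Proof. exact: add_subgroup_subring. Qed.

Lemma horner_central p q : (p * q).[a] = p.[a] * q.[a].
Proof. by apply: hornerM_comm; apply: aC. Qed.

Lemma horner_pseudo_red f s p : (pseudo_red f s p).[a] =
  lead_coef f * s * p.[a] - f.[a] * (s * lead_coef p * a ^+ (size p - size f)).
Proof.
by rewrite /pseudo_red hornerD hornerN !horner_central !hornerC hornerXn !mulrA.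
Qed.

Lemma sub_adjoin : T `<=` T'.
Proof.
move=> t Tt; exists t%:P; last by rewrite hornerC.
exact: poly_overC.
Qed.

Lemma adjoin_gen : T' a.
Proof.
exists 'X; last by rewrite hornerX.
move=> i; rewrite coefX; case: eqP => _; first by case: hT.
by case: hA.
Qed.

Lemma subring_adjoin : subring_set T'.
Proof.
split; first by apply: sub_adjoin; case: hT.
- move=> _ _ [p hp <-] [q hq <-]; exists (p - q); last by rewrite hornerD hornerN.
  exact: poly_overB.
- move=> _ _ [p hp <-] [q hq <-]; exists (p * q); last exact: horner_central.
  exact: poly_overM.
Qed.

Lemma adjoin_ind (M : set W) : add_subgroup M -> T `<=` M ->
  (forall x, M x -> M (x * a)) -> T' `<=` M.
Proof.
move=> hM TM Ma _ [p hp <-]; rewrite horner_coef.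
apply: add_subgroup_sum => // i _.
move: p`_i (hp i) => c /TM Mc.
by elim: (i : nat) => [|n IH]; rewrite ?expr0 ?mulr1 // exprSr mulrA; apply: Ma.
Qed.

Lemma annihil_adjoin x y : (forall s, T s -> x * s * y = 0) ->
  forall s, T' s -> x * s * y = 0.
Proof.
move=> h; apply: (@adjoin_ind [set s | x * s * y = 0]) => //.
  by split=> [|s t] /=; rewrite ?mulr0 ?mul0r // mulrBr mulrBl => -> ->; rewrite subrr.
by move=> s /= hs; rewrite -!mulrA (aC y) !mulrA hs mul0r.
Qed.

Hypothesis prime0 : prime_in T' [set 0].

Lemma annihil0 x y : T' x -> T' y ->
  (forall s, T s -> x * s * y = 0) -> x = 0 \/ y = 0.
Proof.
move=> hx hy h; have [_ _ hP] := prime0.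
by apply: (hP _ _ hx hy); apply: annihil_adjoin.
Qed.

Lemma annihil0T x y : T x -> T y -> x != 0 -> y != 0 ->
  exists2 s, T s & x * s * y != 0.
Proof.
move=> hx hy x0 y0; apply: contrapT => h.
case: (@annihil0 x y); [exact: sub_adjoin..| |exact/eqP|exact/eqP].
by move=> s Ts; apply/eqP/negPn/negP => hs; apply: h; exists s.
Qed.

Lemma ideal_adjoin M : ideal_in T M -> ideal_in T' (adjoin M a).
Proof.
move=> hI; have [MT hM _ _] := hI; split.
- by move=> _ [p hp <-]; exists p => // i; apply: MT.
- split; first by exists 0; [move=> i; rewrite coef0; case: hM|rewrite horner0].
  move=> _ _ [p hp <-] [q hq <-]; exists (p - q); first exact: poly_overB.
  by rewrite hornerD hornerN.
- move=> _ _ [p hp <-] [q hq <-]; exists (p * q); last exact: horner_central.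
  exact: (poly_overMl hI).
- move=> _ _ [p hp <-] [q hq <-]; exists (q * p); last exact: horner_central.
  exact: (poly_overMr hI).
Qed.

(** Gauss's argument. If [i] and [j] are the highest indices at which [p] and [q] have coefficients
    outside [M], then modulo [M] the coefficient of index [i + j] in [p * s%:P * q] is the single
    product of these two with [s] between them. *)
Lemma prime_in_transcendental M :
  (forall p, poly_over T p -> p.[a] = 0 -> p = 0) ->
  prime_in T M -> prime_in T' (adjoin M a)
    /\ forall p, poly_over T p -> adjoin M a p.[a] -> poly_over M p.
Proof.
move=> tr [hI M1 hP]; have [MT hM Ml Mr] := hI.
have inv p : poly_over T p -> adjoin M a p.[a] -> poly_over M p.
  move=> hp [q hq e]; suff -> : p = q by [].
  have hq' : poly_over T q by move=> i; apply: MT.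
  apply/eqP; rewrite -subr_eq0; apply/eqP/tr; first exact: poly_overB.
  by rewrite hornerD hornerN e subrr.
split=> //; split; first exact: ideal_adjoin.
- move=> h; apply: M1; have := @inv 1%:P; rewrite hornerC => /(_ _ h 0).
  by rewrite coefC /=; apply; apply: poly_overC => //; case: hT.
- move=> _ _ [p hp <-] [q hq <-] h.
  have top r : poly_over T r -> ~ adjoin M a r.[a] -> exists i,
      ~ M r`_i /\ forall j, (i < j)%N -> M r`_j.
    move=> hr nr; have [i /asboolP hi] : exists i, `[< ~ M r`_i >].
      apply: contrapT => n; apply: nr; exists r => // i.
      by apply: contrapT => ni; apply: n; exists i; apply/asboolP.
    have bd j : `[< ~ M r`_j >] -> (j <= size r)%N.
      move=> /asboolP nj; rewrite leqNgt; apply/negP => lt; apply: nj.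
      by rewrite nth_default ?(ltnW lt) //; case: hM.
    have ex : exists i, `[< ~ M r`_i >] by exists i; apply/asboolP.
    case: (ex_maxnP ex bd) => m /asboolP nm mx; exists m; split=> // j lt.
    apply: contrapT => nj; have /mx : `[< ~ M r`_j >] by apply/asboolP.
    by rewrite leqNgt lt.
  apply: contrapT => /not_orP[/(top _ hp)[i [ni gi]] /(top _ hq)[j [nj gj]]].
  case: (hP p`_i q`_j (hp i) (hq j)) => // s Ts.
  have hps : poly_over T (p * s%:P) by apply: poly_overM => //; apply: poly_overC.
  have hc : M (p * s%:P * q)`_(i + j).
    apply: inv; first exact: poly_overM.
    by rewrite !horner_central hornerC; apply: h; apply: sub_adjoin.
  move: hc; rewrite coefM (bigD1 (inord i)) //=.
  rewrite inordK ?ltnS ?leq_addr // addKn coefMC => hc.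
  rewrite -[X in M X](addrK (\sum_(l < (i + j).+1 | l != inord i)
    (p * s%:P)`_l * q`_(i + j - l))).
  have [_ MB] := hM; apply: MB => //; apply: add_subgroup_sum => // l nl.
  have hl : (l : nat) != i.
    by apply: contraNneq nl => e; apply/eqP/val_inj; rewrite /= inordK // ltnS leq_addr.
  rewrite coefMC; case: (ltngtP i l) hl => // lt _.
    by do 2!apply: (Mr) => //; apply: gi.
  apply: Ml; first by rewrite -coefMC; apply: hps.
  by apply: gj; lia.
Qed.

Section Algebraic.
Variable f : {poly W}.
Hypotheses (hf : poly_over T f) (f0 : f != 0) (fa : f.[a] = 0).
Hypothesis fmin :
  forall p, poly_over T p -> p.[a] = 0 -> (size p < size f)%N -> p = 0.

Let c := lead_coef f.
Let Tc : T c. Proof. by rewrite /c lead_coefE; apply: hf. Qed.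
Let c0 : c != 0. Proof. by rewrite lead_coef_eq0. Qed.
Let sf : (0 < size f)%N. Proof. by rewrite size_poly_gt0. Qed.

(* Take g of least degree with g(a) in D nonzero, and let e be its leading
   coefficient. Minimality gives e s g = g s e for all s in T, so that dividing f
   by g yields e s f = g q with deg q < deg f. If g is not constant, then
   g(a) T e q(a) = 0, contradicting the minimality of f. *)
Lemma algebraic_meet (D : set W) d : ideal_in T' D -> D d -> d != 0 ->
  exists e, [/\ T e, D e & e != 0].
Proof.
move=> [DT hD Dl Dr] Dd d0; have [D0 DB] := hD.
pose good n := `[< exists g, [/\ poly_over T g, D g.[a], g.[a] != 0 & size g = n] >].
have exg : exists n, good n.
  case: (DT _ Dd) => g hg e; exists (size g); apply/asboolP; exists g.
  by split=> //; rewrite e.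
case: (ex_minnP exg) => m /asboolP[g [hg Dg g0 sg]] gmin; rewrite -{}sg {m} in gmin.
have {}gmin p : poly_over T p -> D p.[a] -> (size p < size g)%N -> p.[a] = 0.
  move=> hp Dp lt; apply/eqP/negPn/negP => p0.
  have /gmin : good (size p) by apply/asboolP; exists p.
  by rewrite leqNgt lt.
have gn0 : g != 0 by apply: contraNneq g0 => ->; rewrite horner0.
have sgp : (0 < size g)%N by rewrite size_poly_gt0.
pose e := lead_coef g.
have Te : T e by rewrite /e lead_coefE; apply: hg.
have e0 : e != 0 by rewrite lead_coef_eq0.
have [sg1|sg1] := leqP (size g) 1.
  exists g`_0; have := size1_polyC sg1 => eg.
  by rewrite eg hornerC in Dg g0; split.
have Tg' : T' g.[a] by exists g.
have [_ _ TM] := hT.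
have Dred h s p : poly_over T h -> D h.[a] -> T s -> poly_over T p -> D p.[a] ->
    D (pseudo_red h s p).[a].
  move=> hh Dh Ts hp Dp; rewrite horner_pseudo_red; apply: DB.
    by apply: Dl => //; apply: sub_adjoin; apply: TM => //; apply: hh.
  apply: Dr => //; exists ((s * lead_coef p)%:P * 'X^(size p - size h)).
    by apply: poly_overMXn => //; apply: poly_overC => //; apply: TM => //; apply: hp.
  by rewrite horner_central hornerC hornerXn.
(* Otherwise pseudo-reducing [g] by [f] gives polynomials shorter than [g] with values [c * s *
   g.[a]] in [D]. These values vanish for all [s], against the primality of zero. *)
have sgf : (size g < size f)%N.
  rewrite ltnNge; apply/negP => le.
  case: (@annihil0 c g.[a]) => //; first exact: sub_adjoin.
  - move=> s Ts; have := gmin (pseudo_red f s g).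
    rewrite {2}horner_pseudo_red fa mul0r subr0; apply.
    + exact: poly_over_pseudo_red.
    + by apply: Dred => //; rewrite fa.
    + by apply: size_pseudo_red; rewrite sf.
  - exact/eqP.
  - exact/eqP.
have small p : poly_over T p -> D p.[a] -> (size p < size g)%N -> p = 0.
  by move=> hp Dp lt; apply: fmin => //; [apply: gmin|apply: ltn_trans sgf].
have comm s : T s -> (e * s)%:P * g = g * (s * e)%:P.
  move=> Ts; have : pseudo_red g s g = 0.
    apply: small; [exact: poly_over_pseudo_red|exact: Dred|].
    by apply: size_pseudo_red; rewrite sgp /=.
  by rewrite /pseudo_red subnn expr0 mulr1 => /eqP; rewrite subr_eq0 => /eqP.
(* [T] may have zero divisors, so the multiplier [e * s] accumulated in the division is kept from
   killing a given [y]. Taking [y] to be [c] in the end keeps the top coefficient of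
   [(e * s)%:P * f] nonzero. *)
have division n p y : (size p <= n)%N -> poly_over T p -> D p.[a] -> T y -> y != 0 ->
    exists s q, [/\ T s, poly_over T q, (size q <= (size p).+1 - size g)%N,
      (e * s)%:P * p = g * q & e * s * y != 0].
  elim: n p y => [|n IH] p y sp hp Dp Ty y0.
    have [s Ts es] := annihil0T Te Ty e0 y0; exists s, 0.
    move: sp; rewrite leqn0 size_poly_eq0 => /eqP ->.
    split=> //; last by rewrite !mulr0.
      by move=> i; rewrite coef0; case: hA.
    by rewrite size_poly0.
  have [lt|le] := ltnP (size p) (size g).
    have [s Ts es] := annihil0T Te Ty e0 y0; exists s, 0.
    rewrite (small p) // !mulr0; split=> //.
      by move=> i; rewrite coef0; case: hA.
    by rewrite size_poly0.
  have [s Ts es] := annihil0T Te Ty e0 y0.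
  have lt : (size (pseudo_red g s p) < size p)%N by apply: size_pseudo_red; rewrite sgp.
  have Tesy : T (e * s * y) by do 2!apply: (TM) => //.
  have hr := poly_over_pseudo_red hT hg Ts hp.
  have Tlp : T (lead_coef p) by apply: hp.
  have [|s1 [q1 [Ts1 hq1 sq1 eq1 ney]]] :=
    IH _ _ _ hr (Dred _ _ _ hg Dg Ts hp Dp) Tesy es.
    by rewrite -ltnS; apply: leq_trans lt sp.
  exists (s1 * e * s), (q1 + (s1 * e)%:P * (s * lead_coef p)%:P * 'X^(size p - size g)).
  have Ts1e : T (s1 * e) by apply: TM.
  have hq2 : poly_over T ((s1 * e)%:P * (s * lead_coef p)%:P * 'X^(size p - size g)).
    apply: poly_overMXn => //; rewrite -polyCM.
    by apply: poly_overC => //; do 2!apply: (TM) => //.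
  split; first by do 2!apply: (TM) => //.
  - move=> i; rewrite coefD; exact: add_subgroupD.
  - apply: leq_trans (size_polyD _ _) _; rewrite geq_max; apply/andP; split.
      by apply: leq_trans sq1 _; apply: leq_sub2r; rewrite ltnS ltnW.
    apply: leq_trans (size_polyMleq _ _) _.
    rewrite size_polyXn -polyCM; move: (size_polyC_leq1 (s1 * e * (s * lead_coef p))).
    by move: (size _%:P) => l; lia.
  - have -> : (e * (s1 * e * s))%:P * p =
        (e * s1)%:P * ((e * s)%:P * p) by rewrite !polyCM !mulrA.
    have -> : (e * s)%:P * p =
        pseudo_red g s p + g * (s * lead_coef p)%:P * 'X^(size p - size g).
      by rewrite /pseudo_red subrK.
    by rewrite mulrDr eq1 mulrDr !mulrA comm.
  - by move: ney; rewrite !mulrA.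
apply: contrapT => none.
have [|s [q [Ts hq sq eq ney]]] := division (size f) f c (leqnn _) hf _ Tc c0.
  by rewrite fa.
have sqf : (size q < size f)%N.
  by lia.
have gq : g * q != 0.
  rewrite -eq; apply: contraNneq ney => /(congr1 (fun r : {poly W} => r`_(size f).-1)).
  by rewrite coefCM coef0 -lead_coefE => ->.
have Teq : poly_over T (e%:P * q) by apply: poly_overM => //; apply: poly_overC.
have eqa : (e%:P * q).[a] = 0.
  case: (@annihil0 g.[a] (e%:P * q).[a]) => //.
  - by exists (e%:P * q).
  - move=> t Tt; rewrite horner_central hornerC mulrA -(mulrA _ t).
    have := congr1 (fun p => (p * q).[a]) (comm t Tt).
    rewrite /= -mulrA -eq !horner_central !hornerC fa !mulr0 => <-.
    by [].
  - by move/eqP; rewrite (negbTE g0).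
have eq0 : e%:P * q = 0.
  apply: fmin => //; apply: leq_ltn_trans sqf; rewrite mul_polyC.
  exact: size_scale_leq.
have [i gqi] : exists i, (g * q)`_i != 0.
  by exists (size (g * q)).-1; rewrite -lead_coefE lead_coef_eq0.
(* Multiplying [g * q] by [e * t] gives [g * (t * e)%:P * q], which is zero for every [t] in [T],
   although [e] and some coefficient of [g * q] are nonzero. *)
have [t Tt] := annihil0T Te (poly_overM hT hg hq i) e0 gqi.
rewrite -coefCM mulrA comm // polyCM -!mulrA eq0 !mulr0 coef0 eqxx.
by [].
Qed.

(* Pseudo-division by f shows that M T[a] meets T in M only. *)
Lemma algebraic_lying_over M p : prime_in T M -> ~ M c -> poly_over T p ->
  (forall i, (0 < i)%N -> M p`_i) -> p.[a] = 0 -> M p`_0.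
Proof.
move=> [[MT hM Ml Mr] M1 hP] Mc.
have [n] := ubnP (size p); elim: n p => // n IH p; rewrite ltnS => sp hp hi pa.
have [lt|le] := ltnP (size p) (size f).
  by rewrite (fmin hp pa lt) coef0; case: hM.
have [_ _ TM] := hT.
(* A nonzero constant does not vanish at [a]. So [p] has positive degree here, and its leading
   coefficient is among those known to lie in [M]. *)
have sf2 : (1 < size f)%N.
  rewrite ltnNge; apply: contra f0 => /size1_polyC e.
  by move: fa; rewrite e hornerC => ->.
case: (hP c p`_0 Tc (hp 0%N)) => // s Ts.
have Mtop : M (lead_coef p).
  by rewrite lead_coefE; apply: hi; rewrite -subn1 subn_gt0 (leq_trans sf2).
have hred : poly_over M (f * (s * lead_coef p)%:P * 'X^(size p - size f)).
  apply: poly_overMXn => //; apply: (@poly_overMl T) => //.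
  by apply: poly_overC => //; apply: Ml.
have : M (pseudo_red f s p)`_0.
  apply: IH.
  - by apply: leq_trans sp; apply: size_pseudo_red; rewrite sf.
  - exact: poly_over_pseudo_red.
  - move=> i i0; rewrite /pseudo_red coefB coefCM.
    case: hM => _ MB; apply: MB => //; apply: Ml; last exact: hi.
    exact: TM.
  - by rewrite horner_pseudo_red pa fa mulr0 mul0r subr0.
rewrite /pseudo_red coefB coefCM -/c => h.
by rewrite -[c * s * p`_0](subrK ((f * (s * lead_coef p)%:P *
  'X^(size p - size f))`_0)); apply: add_subgroupD.
Qed.

(** The witness is [c * s * e1], with [e1] in [T] and in the ideal generated by [d]. A prime [M]
    avoiding it avoids [c], so that some [M'] lies over [M], and avoids [e1], so that [d] is outside
    [M']. *)
Lemma prime_lift_algebraic d : T' d -> d != 0 ->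
  exists e, [/\ T e, e != 0 & forall M, prime_in T M -> ~ M e ->
    exists M', [/\ prime_in T' M', M `<=` M' & ~ M' d]].
Proof.
move=> Td d0; have hT' := subring_adjoin.
have hD : ideal_in T' (ideal_gen T' [set d]) by apply: ideal_in_gen => // _ ->.
have [|e1 [Te1 De1 e10]] := algebraic_meet hD _ d0; first by move=> N _; apply.
have [s Ts cse] := annihil0T Tc Te1 c0 e10; have [T1 _ TM] := hT.
exists (c * s * e1); split=> //; first by do 2!apply: (TM) => //.
move=> M hM ne; have [hI M1 hP] := hM; have [MT [M0 MB] Ml Mr] := hI.
have nc : ~ M c by move=> h; apply: ne; do 2!apply: (Mr) => //.
have ne1 : ~ M e1 by move=> h; apply: ne; apply: Ml => //; apply: TM.
have [|M' [pM' sM' M'T]] :=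
    prime_lying_over hT' sub_adjoin hT hM (ideal_adjoin hI).
  move=> x Tx [p hp px]; rewrite -[x](subrK p`_0).
  apply: add_subgroupD => //; have := @algebraic_lying_over M (x%:P - p) hM nc.
  rewrite coefB coefC eqxx; apply.
  - apply: poly_overB => //; first exact: poly_overC.
    by move=> i; apply: MT.
  - by case=> // i _; rewrite coefB coefC -[_ - _]/(0 - p`_i.+1); apply: MB.
  - by rewrite hornerD hornerN hornerC px subrr.
exists M'; split=> //.
  by move=> x Mx; apply: sM'; exists x%:P; [exact: poly_overC|rewrite hornerC].
move=> M'd; apply: ne1; apply: M'T => //; apply: De1; first by case: pM'.
by move=> _ ->.
Qed.

End Algebraic.

Lemma prime_lift_step d : T' d -> d != 0 ->
  exists e, [/\ T e, e != 0 & forall M, prime_in T M -> ~ M e ->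
    exists M', [/\ prime_in T' M', M `<=` M' & ~ M' d]].
Proof.
move=> Td d0.
pose rel n := `[< exists f, [/\ poly_over T f, f != 0, f.[a] = 0 & size f = n] >].
have [[n hn]|nrel] := pselect (exists n, rel n).
  case: (ex_minnP (ex_intro _ n hn)) => m /asboolP[f [hf f0 fa <-]] fmin.
  apply: (prime_lift_algebraic hf f0 fa) => // p hp pa; apply: contraTeq => p0.
  by rewrite -leqNgt; apply: fmin; apply/asboolP; exists p.
have tr p : poly_over T p -> p.[a] = 0 -> p = 0.
  move=> hp pa; apply/eqP/negPn/negP => p0; apply: nrel; exists (size p).
  by apply/asboolP; exists p.
case: Td => p hp pd; have p0 : p != 0 by apply: contraNneq d0 => p0; rewrite -pd p0 horner0.
(* In the transcendental case [adjoin M a] is the required prime; it misses [d] as soon as one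
   coefficient of [p] is outside [M]. *)
exists (lead_coef p); split; [exact: hp|by rewrite lead_coef_eq0|].
move=> M hM ne; have [pM' inv] := prime_in_transcendental tr hM.
have [[MT hA' _ _] _ _] := hM.
exists (adjoin M a); split=> //.
- by move=> x Mx; exists x%:P; [exact: poly_overC|rewrite hornerC].
- by rewrite -pd => /(inv _ hp)/(_ (size p).-1); rewrite -lead_coefE.
Qed.

End Step.

Lemma foldl_adjoin T (s : seq W) : subring_set T ->
  (forall a w : W, a \in s -> a * w = w * a) ->
  subring_set (foldl adjoin T s) /\ T `<=` foldl adjoin T s.
Proof.
elim: s T => [|a s IH] T hT hs /=; first by split.
have aC w : a * w = w * a by apply: hs; rewrite inE eqxx.
have [|h1 h2] := IH (adjoin T a) (subring_adjoin hT aC).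
  by move=> b w bs; apply: hs; rewrite inE bs orbT.
by split=> //; apply: subset_trans h2; apply: sub_adjoin.
Qed.

Lemma annihil_foldl_adjoin T (l : seq W) x y :
  subring_set T -> (forall a w : W, a \in l -> a * w = w * a) ->
  (forall s, T s -> x * s * y = 0) ->
  forall s, foldl adjoin T l s -> x * s * y = 0.
Proof.
elim: l T => [|a l IH] T hT hl h //=.
have aC w : a * w = w * a by apply: hl; rewrite inE eqxx.
apply: IH; [exact: subring_adjoin| |exact: annihil_adjoin].
by move=> b w bl; apply: hl; rewrite inE bl orbT.
Qed.

(** Induction on the adjoined elements: the witness [e'] found in [adjoin T a] for the later ones
    becomes the element to avoid in the step from [T] to [adjoin T a]. *)
Lemma prime_lift T (l : seq W) d : subring_set T ->
  (forall a w : W, a \in l -> a * w = w * a) ->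
  prime_in (foldl adjoin T l) [set 0] ->
  foldl adjoin T l d -> d != 0 ->
  exists e, [/\ T e, e != 0 & forall M, prime_in T M -> ~ M e ->
    exists M', [/\ prime_in (foldl adjoin T l) M', M `<=` M' & ~ M' d]].
Proof.
elim: l T => [|a l IH] T hT hl hp Sd d0 /=.
  by exists d; split=> // M hM nd; exists M; split.
have aC w : a * w = w * a by apply: hl; rewrite inE eqxx.
have lC b w : b \in l -> b * w = w * b.
  by move=> bl; apply: hl; rewrite inE bl orbT.
have hT' := subring_adjoin hT aC.
have [e' [Te' e'0 lift']] := IH _ hT' lC hp Sd d0.
(* Zero is prime in the intermediate ring as well, because the remaining generators are central and
   cannot undo an annihilation. *)
have p0 : prime_in (adjoin T a) [set 0].
  have [hS TS] := foldl_adjoin hT' lC; have [_ n1 hP] := hp.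
  split=> //; last first.
    move=> x y Tx Ty h; apply: hP; [exact: TS..|].
    exact: annihil_foldl_adjoin h.
  split.
  - by move=> x ->; case: (add_subgroup_subring hT').
  - by split=> // x y -> ->; rewrite /= subrr.
  - by move=> t x _ ->; rewrite /= mulr0.
  - by move=> t x _ ->; rewrite /= mul0r.
have [e [Te e0 lift]] := prime_lift_step hT aC p0 Te' e'0.
exists e; split=> // M hM ne; have [M1 [pM1 sM1 nM1]] := lift M hM ne.
have [M2 [pM2 sM2 nM2]] := lift' M1 pM1 nM1.
by exists M2; split=> //; apply: subset_trans sM2.
Qed.

End SubringPrimes.
(** * Regular maps *)

Section LinearProjection.
Variables (k : fieldType) (V : lmodType k).
Implicit Types S N : set V.

Definition subspace S := S 0 /\ forall (c : k) x y, S x -> S y -> S (c *: x + y).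

Lemma subspaceD S x y : subspace S -> S x -> S y -> S (x + y).
Proof. by move=> [_ h] Sx Sy; rewrite -[x]scale1r; apply: h. Qed.

Lemma subspaceZ S c x : subspace S -> S x -> S (c *: x).
Proof. by move=> [S0 h] Sx; rewrite -[_ *: _]addr0; apply: h. Qed.

Lemma subspaceB S x y : subspace S -> S x -> S y -> S (x - y).
Proof.
by move=> hS Sx Sy; rewrite -scaleN1r addrC; case: hS => _; apply.
Qed.

(** A subspace [H] maximal among those containing [S] and meeting [N] in zero is a complement of
    [N]; [p] is the projection along [H]. *)
Lemma linear_projection S N : subspace S -> subspace N ->
  (forall x, S x -> N x -> x = 0) ->
  exists p : V -> V, [/\ forall (c : k) x y, p (c *: x + y) = c *: p x + p y,
    forall x, N (p x), forall x, N x -> p x = x & forall x, S x -> p x = 0].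
Proof.
move=> hS hN SN; pose good H := subspace H /\ forall x, H x -> N x -> x = 0.
have [//|F [H0 FH0] Fg _ tF|H [[hH HN] SH maxH]] := @Zorn_above _ good S.
  split; last by move=> x [H /Fg[_ h] Hx]; apply: h.
  split; first by exists H0 => //; have [[]] := Fg _ FH0.
  move=> c x y [H FH Hx] [H' FH' H'y]; have [sub|sub] := tF _ _ FH FH'.
    by exists H' => //; have [[_ h] _] := Fg _ FH'; apply: h => //; apply: sub.
  by exists H => //; have [[_ h] _] := Fg _ FH; apply: h => //; apply: sub.
have dec v : exists n, N n /\ H (v - n).
  apply: contrapT => none.
  pose H' := [set x | exists c h, H h /\ x = c *: v + h].
  have H'H : H' `<=` H.
    apply: (maxH H'); last first.
      by move=> h Hh; exists 0, h; rewrite scale0r add0r.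
    split; first split.
    - by exists 0, 0; rewrite scale0r addr0; split=> //; case: hH.
    - move=> c _ _ [d [h [Hh ->]]] [d' [h' [Hh' ->]]].
      exists (c * d + d'), (c *: h + h'); split; first by case: hH => _; apply.
      by rewrite scalerDr scalerA addrACA -scalerDl.
    - move=> _ [c [h [Hh ->]]] Nx; have [c0|c0] := eqVneq c 0.
        by move: Nx; rewrite c0 scale0r add0r; apply: HN.
      case: none; exists (c^-1 *: (c *: v + h)); split; first exact: subspaceZ.
      rewrite scalerDr scalerA mulVf // scale1r opprD addrA subrr add0r.
      by rewrite -scalerN; apply: subspaceZ => //; rewrite -sub0r;
        apply: subspaceB => //; case: hH.
  apply: none; exists 0; split; first by case: hN.
  by rewrite subr0; apply: H'H; exists 1, 0; rewrite scale1r addr0; split=> //; case: hH.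
have [p hp] := choice dec.
have uniq_dec v n : N n -> H (v - n) -> p v = n.
  move=> Nn Hn; have [Np Hp] := hp v; apply/eqP; rewrite -subr_eq0; apply/eqP/HN.
    have -> : p v - n = (v - n) - (v - p v) by rewrite opprB [RHS]addrC addrA subrK.
    exact: subspaceB.
  exact: subspaceB.
exists p; split.
- move=> c x y; have [Nx Hx] := hp x; have [Ny Hy] := hp y.
  apply: uniq_dec; first by case: hN => _; apply.
  by rewrite opprD addrACA -scalerBr; case: hH => _; apply.
- by move=> x; case: (hp x).
- by move=> x Nx; apply: uniq_dec => //; rewrite subrr; case: hH.
- by move=> x Sx; apply: uniq_dec; [case: hN|rewrite subr0; apply: SH].
Qed.

Lemma separating_form S y : subspace S -> ~ S y ->
  exists l : V -> k, [/\ forall (c : k) u v, l (c *: u + v) = c * l u + l v,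
    forall x, S x -> l x = 0 & l y = 1].
Proof.
move=> hS Sy; pose N := [set x | exists c : k, x = c *: y].
have y0 : y != 0 by apply: contra_notN Sy => /eqP ->; case: hS.
have hN : subspace N.
  split; first by exists 0; rewrite scale0r.
  by move=> c _ _ [d ->] [e ->]; exists (c * d + e); rewrite scalerDl scalerA.
have [|p [plin Np pN pS]] := linear_projection hS hN.
  move=> x Sx [c xc]; have [c0|c0] := eqVneq c 0; first by rewrite xc c0 scale0r.
  case: Sy; rewrite -[y]scale1r -(mulVf c0) -scalerA -xc.
  exact: subspaceZ.
have inj c d : c *: y = d *: y -> c = d.
  move=> /eqP; rewrite -subr_eq0 -scalerBl scaler_eq0 (negbTE y0) orbF subr_eq0.
  by move/eqP.
have [l hl] := choice Np; exists l; split.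
- by move=> c u v; apply: inj; rewrite -hl plin !hl scalerDl scalerA.
- by move=> x /pS; rewrite hl => e; apply: inj; rewrite e scale0r.
- by apply: inj; rewrite -hl scale1r pN //; exists 1; rewrite scale1r.
Qed.

End LinearProjection.

Section RegularMaps.
Variables (k : closedFieldType) (G : affine_group k).

Lemma regular_fun_cst c : regular_fun (fun _ : G => c).
Proof. by exists c%:MP => g; rewrite mevalC. Qed.

Lemma regular_funD (f h : G -> k) : regular_fun f -> regular_fun h ->
  regular_fun (fun g => f g + h g).
Proof. by move=> [p hp] [q hq]; exists (p + q) => g; rewrite mevalD hp hq. Qed.

Lemma regular_funM (f h : G -> k) : regular_fun f -> regular_fun h ->
  regular_fun (fun g => f g * h g).
Proof. by move=> [p hp] [q hq]; exists (p * q) => g; rewrite mevalM hp hq. Qed.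

Lemma regular_funV (f : G -> k) : regular_fun f ->
  regular_fun (fun g => f g^-1%g).
Proof.
move=> [p hp]; have [q hq] := choice (@coord_inv k G).
exists (p \mPo [tuple q i | i < affine_dim G]) => g.
by rewrite comp_mpoly_meval hp; apply: meval_eq => i; rewrite tnth_mktuple hq.
Qed.

(** The elements of the tensor product of the coordinate ring with [V], seen as maps; [V] may have
    infinite dimension. *)
Inductive regular_map (V : lmodType k) : (G -> V) -> Prop :=
| RegularZ h v of regular_fun h : regular_map (fun g => h g *: v)
| RegularD x y of regular_map x & regular_map y :
    regular_map (fun g => x g + y g).

Lemma regular_map_eq (V : lmodType k) (x y : G -> V) :
  (forall g, x g = y g) -> regular_map x -> regular_map y.
Proof. by move=> /funext ->. Qed.

Lemma regular_map_sum (V : lmodType k) (I : Type) (r : seq I) (x : I -> G -> V) :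
  (forall i, regular_map (x i)) -> regular_map (fun g => \sum_(i <- r) x i g).
Proof.
move=> hx; elim: r => [|i r IH].
  apply: (@regular_map_eq _ (fun=> 0 *: 0)).
    by move=> g; rewrite big_nil scaler0.
  by apply: (@RegularZ _ (fun=> 0)); apply: regular_fun_cst.
apply: regular_map_eq (RegularD (hx i) IH) => g.
by rewrite big_cons.
Qed.

Lemma regular_map_scale (V : lmodType k) h (x : G -> V) : regular_fun h ->
  regular_map x -> regular_map (fun g => h g *: x g).
Proof.
move=> hh; elim=> [f v hf|{}x y _ hx _ hy].
  by apply: regular_map_eq (RegularZ v (regular_funM hh hf)) => g; rewrite scalerA.
by apply: regular_map_eq (RegularD hx hy) => g; rewrite scalerDr.
Qed.

Lemma regular_mapV (V : lmodType k) (x : G -> V) :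
  regular_map x -> regular_map (fun g => x g^-1%g).
Proof.
elim=> [f v hf|{}x y _ hx _ hy]; last exact: RegularD.
exact: RegularZ (regular_funV hf).
Qed.

Lemma regular_map_form (V : lmodType k) (l : V -> k) (x : G -> V) :
  (forall (c : k) u v, l (c *: u + v) = c * l u + l v) ->
  regular_map x -> regular_fun (fun g => l (x g)).
Proof.
move=> llin.
have l0 : l 0 = 0.
  have := llin 1 0 0; rewrite scaler0 addr0 mul1r => /eqP.
  by rewrite -subr_eq0 opprD addNKr oppr_eq0 => /eqP.
elim=> [f v [p hp]|{}x y _ hx _ hy].
  exists (p * (l v)%:MP) => g.
  by rewrite mevalM mevalC -hp -[f g *: v]addr0 llin l0 addr0.
have [p hp] := regular_funD hx hy; exists p => g.
by rewrite -hp -[x g]scale1r llin mul1r scale1r.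
Qed.

Lemma regular_map_separate (V : lmodType k) (S : set V) (x : G -> V) g0 :
  subspace S -> regular_map x -> ~ S (x g0) ->
  exists h, [/\ regular_fun h, h g0 != 0 & forall g, S (x g) -> h g = 0].
Proof.
move=> hS hx nS; have [l [llin lS l1]] := separating_form hS nS.
exists (fun g => l (x g)); split; first exact: regular_map_form.
  by rewrite l1 oner_neq0.
by move=> g /lS.
Qed.

(** Linear forms turn the avoidance of [S] and of [T] into the nonvanishing of two regular
    functions, whose product is nonzero somewhere on the irreducible set [X]. *)
Lemma irreducible_avoid (V : lmodType k) (S T : set V) (x y : G -> V)
    (X : set G) : irreducible_set X -> subspace S -> subspace T ->
  regular_map x -> regular_map y ->
  (exists2 g, X g & ~ S (x g)) -> (exists2 g, X g & ~ T (y g)) ->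
  exists g, [/\ X g, ~ S (x g) & ~ T (y g)].
Proof.
move=> [_ irr] hS hT hx hy [g1 X1 n1] [g2 X2 n2].
have [f [hf f1 fS]] := regular_map_separate hS hx n1.
have [h [hh h2 hT']] := regular_map_separate hT hy n2.
apply: contrapT => none; case: (irr f h hf hh).
- move=> g Xg; apply: contrapT => /eqP; rewrite mulf_eq0 => /norP[fg hg].
  apply: none; exists g; split=> // [/fS e|/hT' e]; first by rewrite e eqxx in fg.
  by rewrite e eqxx in hg.
- by move=> /(_ _ X1) e; rewrite e eqxx in f1.
- by move=> /(_ _ X2) e; rewrite e eqxx in h2.
Qed.

Variables (R : algType k) (a : alg_action G R).
Hypothesis a_rational : rational_action a.

Lemma regular_map_orbit r : regular_map (fun g => a g r).
Proof.
have [n [v [rho [_ [c ->] [_ _ hrho _] hv]]]] := a_rational r.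
apply: (@regular_map_eq _
  (fun g => \sum_(j < n) \sum_(i < n) (c j * rho g i j) *: v i)).
  move=> g; rewrite raddf_sum; apply: eq_bigr => j _.
  by rewrite /= linearZ /= hv scaler_sumr; apply: eq_bigr => i _; rewrite scalerA.
apply: regular_map_sum => j; apply: regular_map_sum => i.
apply: (@RegularZ _ (fun g => c j * rho g i j)).
by apply: regular_funM; [exact: regular_fun_cst|exact: hrho].
Qed.

Lemma ideal_subspace (I : set R) : two_sided_ideal I -> subspace I.
Proof.
move=> [hI Il _]; split; first by case: hI.
by move=> c x y Ix Iy; apply: add_subgroupD => //; rewrite -mulr_algl; apply: Il.
Qed.

(** The index counts the summands; induction on it takes the place of choosing a shortest
    expression. *)
Inductive twisted : nat -> (G -> R) -> Prop :=
| Twisted0 : twisted 0 (fun=> 0)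
| TwistedS n h r x of regular_fun h & twisted n x :
    twisted n.+1 (fun g => h g *: a g r + x g).

Lemma twistedP n x : twisted n x ->
  if n is m.+1 then exists h r y, [/\ regular_fun h, twisted m y
    & forall g, x g = h g *: a g r + y g] else x = fun=> 0.
Proof. by case=> // m h r y hh hy; exists h, r, y. Qed.

Lemma twistedD m n x y : twisted m x -> twisted n y ->
  twisted (m + n) (fun g => x g + y g).
Proof.
move=> hx hy; elim: hx => [|{}m h r {}x hh _ IH].
  by have -> : (fun g => 0 + y g) = y by apply: funext => g; rewrite add0r.
have -> : (fun g => h g *: a g r + x g + y g) = (fun g => h g *: a g r + (x g + y g)).
  by apply: funext => g; rewrite addrA.
exact: TwistedS.
Qed.

Lemma twisted_regular n x : twisted n x -> regular_map x.
Proof.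
elim=> [|{}n h r {}x hh _ IH].
  apply: regular_map_eq (RegularZ 0 (regular_fun_cst 0)) => g.
  by rewrite scaler0.
by apply: RegularD => //; apply: regular_map_scale => //; apply: regular_map_orbit.
Qed.

(** Each [r] becomes [u * r - r * w], while the coefficients and the number of terms stay the same.
    With [r * t] and [t * r] for [u] and [w], the term of [r] itself disappears. *)
Lemma twisted_commutator n x u w : twisted n x ->
  twisted n (fun g => a g u * x g - x g * a g w).
Proof.
elim=> [|{}n h r {}x hh _ IH].
  have -> : (fun g => a g u * 0 - 0 * a g w) = (fun=> 0 : R).
    by apply: funext => g; rewrite mulr0 mul0r subr0.
  exact: Twisted0.
have -> : (fun g => a g u * (h g *: a g r + x g) - (h g *: a g r + x g) * a g w) =
    (fun g => h g *: a g (u * r - r * w) + (a g u * x g - x g * a g w)).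
  apply: funext => g; rewrite raddfB /= !rmorphM mulrDr mulrDl opprD addrACA.
  by rewrite -scalerAr -scalerAl scalerBr.
exact: TwistedS.
Qed.

(** Write [r] as [a g (a g^-1 r)] and expand the inner map, which is regular. *)
Lemma twisted_cst r : exists n, twisted n (fun=> r).
Proof.
suff h x : regular_map x -> exists n, twisted n (fun g => a g (x g)).
  have [n hn] := h _ (regular_mapV (regular_map_orbit r)); exists n.
  by rewrite (_ : (fun=> r) = (fun g => a g (a g^-1%g r))) //;
    apply: funext => g; rewrite actionVK.
elim=> [f v hf|{}x y _ [m hm] _ [n hn]].
  exists 1%N; rewrite (_ : (fun g => _) = (fun g => f g *: a g v + 0)).
    by apply: TwistedS => //; apply: Twisted0.
  by apply: funext => g; rewrite linearZ addr0.
exists (m + n)%N; rewrite (_ : (fun g => _) = (fun g => a g (x g) + a g (y g))).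
  exact: twistedD.
by apply: funext => g; rewrite raddfD.
Qed.

Definition core (X : set G) (I : set R) : set R :=
  [set r | forall g, X g -> I (a g r)].

(* Take a shortest nonzero x = \sum_i f_i(g) g.r_i with values in Q / P. The
   shorter element (r_1 t) x - x (t r_1) vanishes mod P, so that x(g) is
   a multiple of g.r_1 mod P, by rationality of P. *)
Lemma core_grow (P : spec R) (Q : set R) (X : set G) : rational_prime P ->
  two_sided_ideal Q -> spec_set P `<=` Q -> ~ Q `<=` P -> irreducible_set X ->
  exists r, core X Q r /\ ~ core X P r.
Proof.
move=> ratP hQ PQ nQP hX.
have sP := ideal_subspace (spec_ideal P); have sQ := ideal_subspace hQ.
have [q [Qq Pq]] : exists q, Q q /\ ~ spec_set P q.
  by apply: contrapT => none; apply: nQP => q Qq; apply: contrapT => Pq; apply: none; exists q.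
suff main n : forall x, twisted n x -> (forall g, X g -> Q (x g)) ->
    (exists2 g, X g & ~ spec_set P (x g)) -> exists r, core X Q r /\ ~ core X P r.
  have [n hn] := twisted_cst q; apply: (main _ _ hn) => //.
  by have [[g Xg] _] := hX; exists g.
elim: n => [|n IH] x /twistedP.
  by move=> -> _ [g _ []]; case: sP.
move=> [h [r [y [hh hy ex]]]] xQ xP.
have [rP|nrP] := pselect (core X P r).
  have Phr g : X g -> spec_set P (h g *: a g r).
    by move=> Xg; apply: subspaceZ => //; apply: rP.
  have ey g : y g = x g - h g *: a g r by rewrite ex addrAC subrr add0r.
  apply: (IH y hy) => [g Xg|].
    by rewrite ey; apply: subspaceB => //; [exact: xQ|apply/PQ/Phr].
  have [g Xg ng] := xP; exists g => // yP; apply: ng.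
  by rewrite ex; apply: subspaceD => //; apply: Phr.
have [all0|] := pselect (forall t g, X g ->
    spec_set P (a g (r * t) * x g - x g * a g (t * r))); last first.
  move=> /existsNP[t /existsNP[g /not_implyP[Xg ng]]].
  have e g' : a g' (r * t) * x g' - x g' * a g' (t * r) =
      a g' (r * t) * y g' - y g' * a g' (t * r).
    rewrite ex mulrDr mulrDl opprD addrACA -scalerAr -scalerAl -!rmorphM.
    by rewrite mulrA subrr add0r.
  apply: (IH _ (twisted_commutator (r * t) (t * r) hy)).
    move=> g' Xg'; rewrite -e; have [_ Ql Qr] := hQ.
    by apply: subspaceB => //; [apply: Ql|apply: Qr]; apply: xQ.
  by exists g; rewrite -?e.
(* If some [a g r] were outside [Q], irreducibility would give [g'] with [x g'] outside [P] and
   [a g' r] outside [Q]. But [x g'] is in [Q] and is a nonzero multiple of [a g' r] modulo [P]. *)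
exists r; split=> // g Xg; apply: contrapT => nQg.
have hx : twisted n.+1 x.
  by rewrite (_ : x = fun g => h g *: a g r + y g); [exact: TwistedS|exact/funext].
have [|g' [Xg' nP' nQ']] := irreducible_avoid hX sP sQ (twisted_regular hx)
  (regular_map_orbit r) xP; first by exists g.
have nPr : ~ spec_set P (a g' r) by move/PQ.
have [t|c hc] := @rational_proportional _ _ P (a g' r) (x g') ratP nPr.
  have := all0 (a g'^-1%g t) g' Xg'; rewrite !rmorphM /= actionVK.
  by rewrite mulrA.
have c0 : c != 0.
  apply: contra_notN nP' => /eqP c0.
  by move: hc; rewrite c0 scale0r subr0.
apply: nQ'; rewrite -[a g' r]scale1r -(mulVf c0) -scalerA; apply: subspaceZ => //.
rewrite -[c *: _](subKr (x g')); apply: subspaceB => //; first exact: xQ.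
exact: PQ.
Qed.

End RegularMaps.
(** * The generic orbit *)

Lemma foldl_adjoin_ind (W : nzRingType) (T M : set W) (l : seq W) :
  subring_set T -> (forall a w : W, a \in l -> a * w = w * a) ->
  add_subgroup M -> T `<=` M ->
  (forall a x, a \in l -> M x -> M (x * a)) -> foldl (@adjoin W) T l `<=` M.
Proof.
elim: l T => [|a l IH] T hT hl hM TM Ml //=.
have aC w : a * w = w * a by apply: hl; rewrite inE eqxx.
apply: IH => //; first exact: subring_adjoin.
- by move=> b w bl; apply: hl; rewrite inE bl orbT.
- by apply: adjoin_ind => // x; apply: Ml; rewrite inE eqxx.
- by move=> b x bl; apply: Ml; rewrite inE bl orbT.
Qed.

Lemma foldl_adjoin_gen (W : nzRingType) (T : set W) (l : seq W) a :
  subring_set T -> (forall a w : W, a \in l -> a * w = w * a) ->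
  a \in l -> foldl (@adjoin W) T l a.
Proof.
elim: l T => [|b l IH] T hT hl //=.
have bC w : b * w = w * b by apply: hl; rewrite inE eqxx.
have lC c w : c \in l -> c * w = w * c by move=> cl; apply: hl; rewrite inE cl orbT.
have hT' := subring_adjoin hT bC.
rewrite inE => /predU1P[->|al]; last exact: IH.
by have [_ sub] := foldl_adjoin hT' lC; apply: sub; apply: adjoin_gen.
Qed.

Section GenericOrbit.
Variables (k : closedFieldType) (G : affine_group k) (R : algType k).
Variables (a : alg_action G R) (P : spec R) (X : set G).
Hypotheses (a_rational : rational_action a) (hX : irreducible_set X).

Let pi := quo_pi (spec_ideal P).
Let sP : subspace (spec_set P). Proof. exact: ideal_subspace (spec_ideal P). Qed.

Let X_pointed : pointedType := HB.pack {g | X g}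
  (gen_eqMixin {g | X g}) (gen_choiceMixin {g | X g})
  (isPointed.Build {g | X g} (exist _ _ (projT2 (cid (proj1 hX))))).

Fact quo_ring_neq0 : (1 : quo_ring (spec_ideal P)) != 0.
Proof.
apply/eqP => /(quo_pi_eq0 (spec_ideal P) 1) P1.
have [[_ Pl _] /eqP nT _] := specP P.
by apply: nT; apply/seteqP; split=> // x _; rewrite -[x]mulr1; apply: Pl.
Qed.

Let U : nzRingType := HB.pack (quo_ring (spec_ideal P))
  (GRing.PzSemiRing_isNonZero.Build (quo_ring (spec_ideal P)) quo_ring_neq0).

Let W : nzRingType := X_pointed -> U.

Let res (x : G -> R) : W := fun z => pi (x (sval z)).

Let resB x y : res (fun g => x g - y g) = res x - res y.
Proof. by apply: funext => z; rewrite /res /= /pi quo_piB. Qed.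

Let resD x y : res (fun g => x g + y g) = res x + res y.
Proof. by apply: funext => z; rewrite /res /= /pi quo_piD. Qed.

Let resM x y : res (fun g => x g * y g) = res x * res y.
Proof. by apply: funext => z; rewrite /res /= /pi quo_piM. Qed.

Let res0 : res (fun=> 0) = 0.
Proof. by apply: funext => z; apply/quo_pi_eq0; case: sP. Qed.

Let res_eq0 x : res x = 0 <-> forall g, X g -> spec_set P (x g).
Proof.
split=> [e g Xg|h].
  apply/(quo_pi_eq0 (spec_ideal P)).
  exact: (congr1 (fun w : {g | X g} -> quo_ring (spec_ideal P) =>
    w (exist _ g Xg)) e).
by apply: funext => -[g Xg]; apply/quo_pi_eq0; apply: h.
Qed.

Let scalar (h : G -> k) : W := res (fun g => h g *: 1).
Let orb (r : R) : W := res (fun g => a g r).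

Let scalarC h w : scalar h * w = w * scalar h.
Proof.
apply: funext => z.
change (pi (h (sval z) *: 1) * (w z : quo_ring (spec_ideal P)) = w z * pi (h (sval z) *: 1)).
elim/quo_ind: (w z) => u; rewrite /pi -!quo_piM.
by rewrite -scalerAl -scalerAr mul1r mulr1.
Qed.

Let res_scale h x : res (fun g => h g *: x g) = scalar h * res x.
Proof.
rewrite -resM; congr res; apply: funext => g.
by rewrite -scalerAl mul1r.
Qed.

Let T0 : set W := range orb.

Let T0_subring : subring_set T0.
Proof.
split.
- exists 1 => //; apply: funext => z; rewrite /orb /res /= rmorph1.
  by [].
- move=> _ _ [r _ <-] [s _ <-]; exists (r - s) => //.
  by rewrite /orb -resB; congr res; apply: funext => g; rewrite raddfB.
- move=> _ _ [r _ <-] [s _ <-]; exists (r * s) => //.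
  by rewrite /orb -resM; congr res; apply: funext => g; rewrite rmorphM.
Qed.

Let gens : seq W := [seq scalar (fun g => Defs.coord g j) | j <- enum 'I_(affine_dim G)].

Let gensC (b w : W) : b \in gens -> b * w = w * b.
Proof. by move=> /mapP[j _ ->]; apply: scalarC. Qed.

Let F := foldl (@adjoin W) T0 gens.

Let F_subring : subring_set F.
Proof. by have [] := foldl_adjoin T0_subring gensC. Qed.

Let T0F : T0 `<=` F.
Proof. by have [] := foldl_adjoin T0_subring gensC. Qed.

Let F_add : add_subgroup F. Proof. exact: add_subgroup_subring. Qed.

Let F_regular w : F w -> exists2 x, regular_map x & w = res x.
Proof.
move: w; apply: foldl_adjoin_ind => //.
- split.
    exists (fun=> 0 *: 0); last by rewrite scale0r res0.
    by apply: (@RegularZ _ _ _ (fun=> 0)); apply: regular_fun_cst.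
  move=> _ _ [x hx ->] [y hy ->]; exists (fun g => x g + (-1) *: y g).
    apply: RegularD => //; apply: (@regular_map_scale _ _ _ (fun=> -1)) => //.
    exact: regular_fun_cst.
  by rewrite -resB; congr res; apply: funext => g; rewrite scaleN1r.
- by move=> _ [r _ <-]; exists (fun g => a g r) => //; apply: regular_map_orbit.
- move=> _ _ /mapP[j _ ->] [x hx ->].
  exists (fun g => Defs.coord g j *: x g).
    apply: regular_map_scale => //; exists 'X_j => g.
    by rewrite mevalXU.
  by rewrite -scalarC -res_scale.
Qed.

(** Constants come from [T0], since [G] fixes scalars; sums and products with the generators then
    reach every polynomial in the coordinates. *)
Let F_scalar h : regular_fun h -> F (scalar h).
Proof.
have [F1 FB FM] := F_subring.
have cst c : F (scalar (fun=> c)).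
  apply: T0F; exists (c *: 1) => //.
  by rewrite /orb /scalar; congr res; apply: funext => g; rewrite linearZ /= rmorph1.
have sD f f' : scalar (fun g => f g + f' g) = scalar f + scalar f'.
  by rewrite /scalar -resD; congr res; apply: funext => g; rewrite scalerDl.
have sM f f' : scalar (fun g => f g * f' g) = scalar f * scalar f'.
  by rewrite -res_scale; congr res; apply: funext => g; rewrite scalerA.
move=> [p]; elim/mpolyind: p h => [|c m p _ _ IH] h hp.
  rewrite (_ : h = fun=> 0); first exact: cst.
  by apply: funext => g; rewrite hp meval0.
rewrite (_ : h = fun g => c * ('X_[m]).@[Defs.coord g] + p.@[Defs.coord g]); last first.
  by apply: funext => g; rewrite hp mevalD mevalZ.
rewrite sD; apply: add_subgroupD => //; last exact: IH.
rewrite sM; apply: (FM) => //.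
rewrite (_ : (fun g => _) = fun g => \prod_(i < affine_dim G) Defs.coord g i ^+ m i);
  last by apply: funext => g; rewrite mevalX.
elim: (index_enum _) => [|i s IHs].
  rewrite (_ : (fun g => _) = fun=> 1); first exact: cst.
  by apply: funext => g; rewrite big_nil.
rewrite (_ : (fun g => _) = fun g => Defs.coord g i ^+ m i *
    \prod_(j <- s) Defs.coord g j ^+ m j); last first.
  by apply: funext => g; rewrite big_cons.
rewrite sM; apply: (FM) => //.
elim: (m i) => [|e IHe].
  rewrite (_ : (fun g => _) = fun=> 1); first exact: cst.
  by apply: funext => g; rewrite expr0.
rewrite (_ : (fun g => _) = fun g => Defs.coord g i * Defs.coord g i ^+ e).
  rewrite sM; apply: (FM) => //; apply: foldl_adjoin_gen => //.
  by apply/mapP; exists i => //; rewrite mem_enum.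
by apply: funext => g; rewrite exprS.
Qed.

(* Writing r = g.(g^-1.r) shows that F contains the constants, and that the
   constants from a G-stable ideal N lie in the ideal generated by orb N. *)
Let orbit_ideal_cst (M : set W) (N : set R) n : ideal_in F M -> subspace N ->
  (forall r, N r -> M (orb r)) -> (forall g, N (a g n)) -> M (res (fun=> n)).
Proof.
move=> [_ hM Ml _] hN NM Nn.
have s0 : subspace [set (0 : R)].
  by split=> // c x y -> ->; rewrite /= scaler0 addr0.
(* Applying the projection [p] onto [N] to an expansion of [a g^-1 n] moves its vectors into [N]
   without changing its value. *)
have [|p [plin Np pN _]] := linear_projection s0 hN; first by [].
suff main y : regular_map y -> M (res (fun g => a g (p (y g)))).
  have := main _ (regular_mapV (regular_map_orbit a_rational n)).
  rewrite (_ : (fun g => _) = fun=> n) //; apply: funext => g.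
  by rewrite pN // actionVK.
have pD u v : p (u + v) = p u + p v by have := plin 1 u v; rewrite !scale1r.
have p0 : p 0 = 0 by apply/eqP; rewrite -(inj_eq (addrI (p 0))) -pD !addr0.
elim=> [h v hh|x z _ hx _ hz].
  rewrite (_ : (fun g => _) = fun g => h g *: a g (p v)).
    by rewrite res_scale; apply: Ml; [exact: F_scalar|exact: NM].
  by apply: funext => g; rewrite -linearZ -[h g *: v]addr0 plin p0 addr0.
rewrite (_ : (fun g => _) = fun g => a g (p (x g)) + a g (p (z g))).
  by rewrite resD; apply: add_subgroupD.
by apply: funext => g; rewrite pD raddfD.
Qed.

Let F_cst r : F (res (fun=> r)).
Proof.
apply: (@orbit_ideal_cst F setT) => //; first exact: ideal_in_self.
by move=> s _; apply: T0F; exists s.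
Qed.

(** At a point [g] where [x] and [y] both avoid [P], any [r] placed between their values is the
    value at [g] of the orbit map of [a g^-1 r], which is in [T0]. So primality of [P] applies. *)
Let F_prime : prime_in F [set 0].
Proof.
split.
- split.
  + by move=> _ ->; case: F_add.
  + by split=> // x y -> ->; rewrite /= subrr.
  + by move=> t x _ ->; rewrite /= mulr0.
  + by move=> t x _ ->; rewrite /= mul0r.
- by have /eqP := oner_neq0 W.
move=> _ _ /F_regular[x hx ->] /F_regular[y hy ->] h.
apply: contrapT => /not_orP[/= nx ny].
have ex z : ~ res z = 0 -> exists2 g, X g & ~ spec_set P (z g).
  move=> nz; apply: contrapT => none; apply: nz; apply/res_eq0 => g Xg.
  by apply: contrapT => ng; apply: none; exists g.
have [g [Xg nPx nPy]] := irreducible_avoid hX sP sP hx hy (ex _ nx) (ex _ ny).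
have [r|//|//] := @prime_idealP _ P (x g) (y g) (specP P).
have : res (fun g' => x g' * a g' (a g^-1%g r) * y g') = 0.
  by rewrite !resM; apply: h; apply: T0F; exists (a g^-1%g r).
by move=> /res_eq0/(_ g Xg); rewrite actionVK.
Qed.

Lemma generic_core d : ~ spec_set P d ->
  (forall Q : spec R, spec_set P `<=` Q -> ~ Q `<=` spec_set P -> spec_set Q d) ->
  exists e, ~ core a X P e /\ forall Q : spec R, core a X P `<=` spec_set Q ->
    ~ spec_set Q e -> forall n, (forall g, spec_set Q (a g n)) ->
    forall g, spec_set P (a g n).
Proof.
move=> Pd hd.
have [|e' [[e _ <-] e0 lift]] :=
  prime_lift T0_subring gensC F_prime (F_cst d).
  by apply/eqP => /res_eq0; have [[g Xg] _] := hX => /(_ g Xg).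
exists e; split; first by move=> h; move/eqP: e0; apply; apply/res_eq0.
move=> Q PQ Qe n Qn.
pose M := [set orb r | r in spec_set Q].
(* [Q] contains the core of [P] along [X], which is the kernel of [orb]. *)
have ME r : M (orb r) -> spec_set Q r.
  move=> [s Qs es]; rewrite -(subrK s r); have [hQ _ _] := spec_ideal Q.
  apply: add_subgroupD => //; apply: PQ => g Xg; rewrite raddfB.
  have : res (fun g => a g r - a g s) = 0 by rewrite resB -/(orb r) -/(orb s) es subrr.
  by move/res_eq0; apply.
have hM : prime_in T0 M.
  have [[Q0 QB] Ql Qr] := spec_ideal Q.
  have orbM r s : orb r * orb s = orb (r * s).
    by rewrite /orb -resM; congr res; apply: funext => g; rewrite rmorphM.
  split; first split.
  - by move=> _ [r _ <-]; exists r.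
  - split; first by exists 0 => //; rewrite -res0; congr res; apply: funext => g; rewrite raddf0.
    move=> _ _ [r Qr' <-] [s Qs <-]; exists (r - s); first exact: QB.
    by rewrite /orb -resB; congr res; apply: funext => g; rewrite raddfB.
  - by move=> _ _ [t _ <-] [s Qs <-]; rewrite orbM; exists (t * s) => //; apply: Ql.
  - by move=> _ _ [t _ <-] [s Qs <-]; rewrite orbM; exists (s * t) => //; apply: Qr.
  - have -> : 1 = orb 1.
      by apply: funext => z; rewrite /orb /res /= rmorph1.
    move=> /ME Q1; have [_ /eqP nT _] := specP Q.
    by apply: nT; apply/seteqP; split=> // x _; rewrite -[x]mulr1; apply: Ql.
  - move=> _ _ [r _ <-] [s _ <-] h.
    have [t|Qr'|Qs] := @prime_idealP _ Q r s (specP Q); first 1 last.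
    + by left; exists r.
    + by right; exists s.
    by apply: ME; rewrite -!orbM; apply: h; exists t.
have [M' [[hM' M'1 M'P] sM nd]] := lift M hM (fun h => Qe (ME _ h)).
have [M'F M'A M'l M'r] := hM'; have [M'0 M'B] := M'A.
pose P' : set R := [set r | M' (res (fun=> r))].
have hP' : prime_ideal P'.
  split; first split.
  - by split=> [|x y hx hy]; rewrite /P' /= ?res0 // resB; apply: M'B.
  - by move=> c x hx; rewrite /P' /= (resM (fun=> c) (fun=> x)); apply: M'l => //; apply: F_cst.
  - by move=> c x hx; rewrite /P' /= (resM (fun=> x) (fun=> c)); apply: M'r => //; apply: F_cst.
  - by apply/eqP => eT; have : P' d by rewrite eT.
  move=> A B hA hB AB; apply: contrapT => /not_orP[nA nB].
  have ex C : ~ C `<=` P' -> exists c, C c /\ ~ P' c.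
    move=> nC; apply: contrapT => none; apply: nC => c Cc.
    by apply: contrapT => nc; apply: none; exists c.
  have [[u [Au nu]] [v [Bv nv]]] := (ex _ nA, ex _ nB).
  (* Elements of [F] are sums of constants [w] times scalar functions, so it is enough that the
     constants [u * w * v] lie in [M']; they come from the product of [A] and [B]. *)
  case: (M'P (res (fun=> u)) (res (fun=> v)));
    [exact: F_cst..| |by []|by []] => _ /F_regular[y hy ->].
  rewrite -!resM; elim: hy => [h w hh|x z _ hx _ hz].
    rewrite (_ : (fun g => _) = fun g => h g *: (u * w * v)).
      rewrite (res_scale h (fun=> u * w * v)); apply: M'l; first exact: F_scalar.
      by apply: AB; apply: ideal_mul_gen => //; have [_ _ Ar] := hA; apply: Ar.
    by apply: funext => g; rewrite -scalerAr -scalerAl.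
  rewrite (_ : (fun g => _) = fun g => u * x g * v + u * z g * v).
    by rewrite resD; apply: add_subgroupD.
  by apply: funext => g; rewrite mulrDr mulrDl.
have PP' : spec_set P `<=` P'.
  move=> r Pr; rewrite /P' /=.
  by have -> : res (fun=> r) = 0 by apply/res_eq0.
(* Otherwise the prime [P'] is strictly above [P] and contains [d], whereas the constant [d] was
   kept out of [M']. *)
have P'P : P' `<=` spec_set P.
  by apply: contrapT => nsub; apply: nd; apply: (hd (Spec hP')).
move=> g; apply: P'P.
apply: (@orbit_ideal_cst M' [set r | forall h, spec_set Q (a h r)]) => //.
- have sQ := ideal_subspace (spec_ideal Q).
  split=> [h|c x y hx hy h]; first by rewrite raddf0; case: sQ.
  by rewrite linearP; case: sQ => _; apply; [apply: hx|apply: hy].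
- by move=> r /(_ 1%g); rewrite action1 => Qr; apply: sM; exists r.
- by move=> h h' /=; rewrite -!actionM.
Qed.

End GenericOrbit.
(** * Locally closed points *)

Lemma spec_eq (U : pzRingType) (P Q : spec U) :
  spec_set P `<=` Q -> spec_set Q `<=` P -> P = Q.
Proof.
case: P Q => [P hP] [Q hQ] /= PQ QP.
have e : P = Q by apply/seteqP.
by case: _ / e hQ {PQ QP} => hQ; rewrite (Prop_irrelevance hP hQ).
Qed.

Lemma closure_spec (U : pzRingType) (P Q : spec U) :
  closure [set P] Q <-> spec_set P `<=` Q.
Proof.
rewrite closureE; split=> [h|PQ C [/closed_openC[I eI] PC]].
  suff: zariski_V P Q by [].
  apply: h; split; last by move=> _ ->.
  by rewrite -[zariski_V P]setCK; apply: open_closedC; exists P; rewrite setCK.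
rewrite setCK in eI; subst C; apply: subset_trans PQ.
exact: (PC P erefl).
Qed.

(** The closure of the point is the set of primes above [P], so an open set isolating it can be
    replaced by the locus avoiding a single [d]. *)
Lemma locally_closed_spec (U : pzRingType) (P : spec U) :
  locally_closed_point P <-> exists d, ~ spec_set P d /\
    forall Q : spec U, spec_set P `<=` Q -> ~ spec_set Q `<=` P -> spec_set Q d.
Proof.
split=> [[O [[I eI] eO]]|[d [Pd hd]]].
  have [PO _] : (O `&` closure [set P]) P by rewrite eO.
  have [d [Id Pd]] : exists d, I d /\ ~ spec_set P d.
    apply: contrapT => none; suff: (~` O) P by [].
    rewrite eI => x Ix; apply: contrapT => nx; apply: none; by exists x.
  exists d; split=> // Q PQ nQP; suff : (~` O) Q by rewrite eI; apply.
  move=> OQ; have : (O `&` closure [set P]) Q by split=> //; apply/closure_spec.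
  by rewrite eO => eQ; apply: nQP; rewrite eQ.
exists (~` zariski_V [set d]); split; first by exists [set d]; rewrite setCK.
apply/seteqP; split=> [Q [nQ /closure_spec PQ]|_ ->].
  apply/esym/spec_eq => //; apply: contrapT => nQP; apply: nQ => _ ->.
  exact: hd.
split; last exact/closure_spec.
by move=> /(_ d erefl).
Qed.

(** * Local closedness in the [G]-spectrum, expressed by primes of [R] *)

Section GLocallyClosed.
Variables (k : closedFieldType) (G : groupType) (R : algType k).
Variable a : alg_action G R.

Lemma gspec_eq (I J : gspec a) : gspec_set I = gspec_set J -> I = J.
Proof.
case: I J => [I hI] [J hJ] /= e.
by case: _ / e hJ => hJ; rewrite (Prop_irrelevance hI hJ).
Qed.

Lemma G_core_sub (Q : set R) : G_core a Q `<=` Q.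
Proof. by move=> x /G_coreP/(_ 1%g); rewrite action1. Qed.

Lemma G_core_max (I Q : set R) : G_stable a I -> I `<=` Q -> I `<=` G_core a Q.
Proof. by move=> hI IQ x Ix; apply/G_coreP => g; apply: IQ; apply: hI; exists x. Qed.

Lemma G_core_stable (Q : set R) : G_stable a (G_core a Q).
Proof. by move=> g _ [x /G_coreP hx <-]; apply/G_coreP => h; rewrite -actionM. Qed.

Fact prime_act g (P : spec R) : prime_ideal [set r | spec_set P (a g r)].
Proof.
have [[P0 PB] Pl Pr] := spec_ideal P; have [_ /eqP nT hP] := specP P; split.
- split; first split.
  + by rewrite /= raddf0.
  + by move=> x y hx hy; rewrite /= raddfB; apply: PB.
  + by move=> c x hx; rewrite /= rmorphM; apply: Pl.
  + by move=> c x hx; rewrite /= rmorphM; apply: Pr.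
- apply/eqP => e; apply: nT; apply/seteqP; split=> // x _.
  by rewrite -(actionVK a g x); have : [set: R] (a g^-1%g x) by []; rewrite -e.
move=> A B [hA Al Ar] [hB Bl Br] AB; apply: contrapT => /not_orP[nA nB].
have ex C : ~ C `<=` [set r | spec_set P (a g r)] ->
    exists c, C c /\ ~ spec_set P (a g c).
  move=> nC; apply: contrapT => none; apply: nC => c Cc.
  by apply: contrapT => nc; apply: none; exists c.
have [[u [Au nu]] [v [Bv nv]]] := (ex _ nA, ex _ nB).
have [r|//|//] := @prime_idealP _ P (a g u) (a g v) (specP P).
rewrite -(actionVK a g r) -!rmorphM; apply: AB.
by apply: ideal_mul_gen => //; apply: Ar.
Qed.

(* This is g^-1.P. *)
Definition spec_act g (P : spec R) : spec R := Spec (prime_act g P).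

Lemma G_core_act g (P : spec R) : G_core a (spec_act g P) = G_core a P.
Proof.
apply/seteqP; split=> r /G_coreP hr; apply/G_coreP => h; last first.
  by have := hr (g * h)%g; rewrite /= actionM.
by have := hr (g^-1 * h)%g; rewrite /= -actionM mulgA mulgV mul1g.
Qed.

(** [gamma] is constant on the translates of [P]. A closed set containing its value there pulls back
    to the primes above some [I], which then lies in every translate of [P], hence in the core. *)
Lemma closure_gspec (P Q : spec R) :
  closure [set gamma a P] (gamma a Q) <-> G_core a P `<=` spec_set Q.
Proof.
rewrite closureE; split=> [h|PQ C [/closed_openC hC PC]].
  suff: [set I : gspec a | G_core a P `<=` gspec_set I] (gamma a Q).
    by move=> /= sub x /sub; apply: G_core_sub.
  apply: h; split; last by move=> _ ->.
  rewrite -[X in closed X]setCK; apply: open_closedC.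
  rewrite /open /= /gspec_open; exists (G_core a P).
  rewrite -preimage_setC setCK; apply/seteqP; split=> Q' /= sub.
    by move=> x /sub; apply: G_core_sub.
  by apply: G_core_max => //; apply: G_core_stable.
have [I eI] : open (gamma a @^-1` (~` C)) by [].
rewrite -preimage_setC setCK in eI.
have memC (Q' : spec R) : C (gamma a Q') <-> I `<=` spec_set Q'.
  by rewrite -[C (gamma a Q')]/((gamma a @^-1` C) Q') eI.
apply/memC => x Ix; apply: PQ; apply/G_coreP => g.
suff /memC/(_ x Ix) : C (gamma a (spec_act g P)) by [].
by apply: PC; apply: gspec_eq; apply: G_core_act.
Qed.

Lemma locally_closed_gspec (P : spec R) :
  locally_closed_point (gamma a P) <-> exists x, ~ spec_set P x /\
    forall Q : spec R, G_core a P `<=` spec_set Q -> ~ G_core a Q `<=` G_core a P ->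
      spec_set Q x.
Proof.
split=> [[O [[I eI] eO]]|[x [Px hx]]].
  have memO (Q : spec R) : ~ O (gamma a Q) <-> I `<=` spec_set Q.
    by rewrite -[~ O (gamma a Q)]/((~` (gamma a @^-1` O)) Q) eI.
  have [PO _] : (O `&` closure [set gamma a P]) (gamma a P) by rewrite eO.
  have [x [Ix Px]] : exists x, I x /\ ~ spec_set P x.
    apply: contrapT => none; have : ~ O (gamma a P); last by [].
    by apply/memO => x Ix; apply: contrapT => nx; apply: none; exists x.
  exists x; split=> // Q PQ nQP; suff /memO/(_ x Ix) : ~ O (gamma a Q) by [].
  move=> OQ; have : (O `&` closure [set gamma a P]) (gamma a Q).
    by split=> //; apply/closure_gspec.
  rewrite eO => /(congr1 (@gspec_set _ _ _ a)) /= eQ; apply: nQP.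
  by rewrite eQ.
pose bad : set (spec R) := [set Q | G_core a P `<=` spec_set Q /\
  ~ G_core a Q `<=` G_core a P].
pose J := \bigcap_(Q in bad) spec_set Q.
(* [G] permutes the primes in [bad], so their intersection is [G]-stable. *)
have JG g r : J r -> J (a g r).
  move=> Jr Q [PQ nQ].
  have : bad (spec_act g Q).
    split; last by rewrite G_core_act.
    by move=> y Py; apply: PQ; apply: G_core_stable; exists y.
  by move/Jr.
exists (~` [set I : gspec a | J `<=` gspec_set I]); split.
  rewrite /open /= /gspec_open; exists J.
  rewrite -preimage_setC setCK; apply/seteqP; split=> Q' /= sub.
    by move=> y /sub; apply: G_core_sub.
  by apply: G_core_max => // g _ [y Jy <-]; apply: JG.
apply/seteqP; split=> [I [/= nJ clI]|_ ->]; last first.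
  split; last by apply/closure_gspec; apply: G_core_sub.
  by move=> /= sub; apply: Px; apply: G_core_sub (sub x _) => Q [? ?]; apply: hx.
(* The image under [gamma] of the primes above the core of [P] is closed in the final topology, so
   it contains the closure of [gamma a P]. *)
have [Q PQ eQ] : (gamma a @` [set Q : spec R | G_core a P `<=` spec_set Q]) I.
  move: clI; rewrite closureE; apply; split; last first.
    by move=> _ ->; exists P => //; apply: G_core_sub.
  rewrite -[X in closed X]setCK; apply: open_closedC.
  rewrite /open /= /gspec_open; exists (G_core a P).
  rewrite -preimage_setC setCK; apply/seteqP; split=> Q /= => [[Q' PQ']|PQ].
    move=> /(congr1 (@gspec_set _ _ _ a)) /= e y Py; apply: G_core_sub.
    by rewrite -e; apply: G_core_max Py => //; apply: G_core_stable.
  by exists Q.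
subst I; apply: gspec_eq; apply/seteqP; split; last first.
  by apply: G_core_max => //; apply: G_core_stable.
apply: contrapT => nQP; apply: nJ; apply: G_core_max.
  by move=> g _ [y Jy <-]; apply: JG.
by move=> y; apply.
Qed.

End GLocallyClosed.

(** * Prime avoidance, prime cores and the equivalence *)

Lemma prime_avoid_seq (U : pzRingType) (I : eqType) (P : spec U) (s : seq I)
    (J : I -> set U) :
  (forall i, i \in s -> two_sided_ideal (J i) /\ ~ J i `<=` spec_set P) ->
  exists x, ~ spec_set P x /\ forall i, i \in s -> J i x.
Proof.
elim: s => [|i s IH] hJ.
  have [[_ Pl _] /eqP nT _] := specP P; exists 1; split=> // P1.
  by apply: nT; apply/seteqP; split=> // x _; rewrite -[x]mulr1; apply: Pl.
have [|x [nx Jx]] := IH; first by move=> j js; apply: hJ; rewrite inE js orbT.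
have [hi /existsNP[y /not_implyP[Jy ny]]] := hJ i (mem_head _ _).
have [r nr] : exists r, ~ spec_set P (x * r * y).
  apply: contrapT => /forallNP h; case: (prime_idealP (specP P) (x := x) (y := y)) => // r.
  by apply: contrapT; apply: h.
exists (x * r * y); split=> // j; rewrite inE => /predU1P[->|js].
  by have [_ Il _] := hi; apply: Il.
have [[_ _ Ir] _] := hJ j (mem_behead (s := i :: s) js).
by do 2!apply: (Ir); apply: Jx.
Qed.

Lemma minimal_in_seq (T : Type) (I : eqType) (J : I -> set T) (s : seq I) :
  s != [::] -> exists2 i, i \in s &
    forall j, j \in s -> J j `<=` J i -> J i `<=` J j.
Proof.
elim: s => // i s IH _; have [->|s0] := eqVneq s [::].
  by exists i; rewrite ?mem_head // => j; rewrite inE => /eqP ->.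
have [m ms mmin] := IH s0.
have [sub|nsub] := pselect (J i `<=` J m).
  exists i; first exact: mem_head.
  move=> j; rewrite inE => /predU1P[-> //|js] ji.
  by apply: subset_trans (mmin j js (subset_trans ji sub)).
exists m; first by rewrite inE ms orbT.
by move=> j; rewrite inE => /predU1P[->|js]; [|exact: mmin].
Qed.

Section CoreIdeal.
Variables (k : closedFieldType) (G : affine_group k) (R : algType k).
Variables (a : alg_action G R).
Hypothesis a_rational : rational_action a.

Lemma core_ideal (X : set G) (I : set R) :
  two_sided_ideal I -> two_sided_ideal (core a X I).
Proof.
move=> [[I0 IB] Il Ir]; split; first split.
- by move=> g _; rewrite raddf0.
- by move=> x y hx hy g Xg; rewrite raddfB; apply: IB; [apply: hx|apply: hy].
- by move=> c x hx g Xg; rewrite rmorphM; apply: Il; apply: hx.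
- by move=> c x hx g Xg; rewrite rmorphM; apply: Ir; apply: hx.
Qed.

(** For [u] and [v] outside the core, irreducibility gives one [g] in [X] that sends both outside
    [P]. *)
Lemma core_prime (X : set G) (P : spec R) : irreducible_set X ->
  prime_ideal (core a X (spec_set P)).
Proof.
move=> hX; have sP := ideal_subspace (spec_ideal P).
have hI := core_ideal X (spec_ideal P); split=> //.
  apply/eqP => e; have [[g Xg] _] := hX; have [[_ Pl _] /eqP nT _] := specP P.
  apply: nT; apply/seteqP; split=> // x _.
  have : core a X (spec_set P) (a g^-1%g x) by rewrite e.
  by move/(_ g Xg); rewrite actionVK.
move=> A B [hA Al Ar] [hB Bl Br] AB; apply: contrapT => /not_orP[nA nB].
have ex C : ~ C `<=` core a X (spec_set P) ->
    exists2 c, C c & exists2 g, X g & ~ spec_set P (a g c).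
  move=> /existsNP[c /not_implyP[Cc /existsNP[g /not_implyP[Xg ng]]]].
  by exists c => //; exists g.
have [[u Au nu] [v Bv nv]] := (ex _ nA, ex _ nB).
have [g [Xg nPu nPv]] := irreducible_avoid hX sP sP
  (regular_map_orbit a_rational u) (regular_map_orbit a_rational v) nu nv.
have [r|//|//] := @prime_idealP _ P (a g u) (a g v) (specP P).
rewrite -(actionVK a g r) -!rmorphM; apply: (AB) => //.
by apply: ideal_mul_gen => //; apply: Ar.
Qed.

End CoreIdeal.

Theorem theorem1 (k : closedFieldType) (G : affine_group k) (R : algType k)
    (a : alg_action G R) (a_rational : rational_action a)
    (P : spec R) (P_rational : rational_prime P) :
  locally_closed_point P <-> locally_closed_point (gamma a P).
Proof.
rewrite locally_closed_spec locally_closed_gspec.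
have [s [hs cs]] := irreducible_cover G.
have s0 : s != [::].
  by apply/eqP => e; have [X] := cs 1%g; rewrite e.
pose C X := core a X (spec_set P).
(* Inclusions will be obtained in [C X0]; its minimality turns an inclusion of [C X] in it into an
   equality, which leads back to [X]. *)
have [X0 X0s X0min] := minimal_in_seq C s0.
pose P0 := Spec (core_prime a_rational P (hs X0 X0s)).
have coreE (Q : set R) x : G_core a Q x <-> forall X, X \in s -> core a X Q x.
  split=> [/G_coreP h X _ g _|h]; first exact: h.
  by apply/G_coreP => g; have [X Xs Xg] := cs g; apply: (h X Xs g Xg).
split=> [[d [Pd hd]]|[x [Px hx]]].
  have /choice[e he] : forall X, exists e, X \in s -> ~ core a X (spec_set P) e /\
      forall Q : spec R, C X `<=` spec_set Q -> ~ spec_set Q e ->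
      forall n, (forall g, spec_set Q (a g n)) -> forall g, spec_set P (a g n).
    move=> X; have [Xs|nXs] := boolP (X \in s); last by exists 0.
    have [e he] := generic_core a_rational (hs X Xs) Pd hd.
    by exists e.
  pose bad (Q : spec R) := G_core a P `<=` spec_set Q /\
    ~ G_core a Q `<=` G_core a P.
  pose J X : set R := [set x | forall Q, bad Q -> C X `<=` spec_set Q -> spec_set Q x].
  have [X Xs|x [nx Jx]] := @prime_avoid_seq _ _ P0 s J.
    split.
      split; first split.
      - by move=> Q _ _; have [[]] := spec_ideal Q.
      - move=> y z hy hz Q bQ CQ; have [[_ QB] _ _] := spec_ideal Q.
        by apply: QB; [apply: hy|apply: hz].
      - by move=> c y hy Q bQ CQ; have [_ Ql _] := spec_ideal Q; apply: Ql; apply: hy.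
      - by move=> c y hy Q bQ CQ; have [_ _ Qr] := spec_ideal Q; apply: Qr; apply: hy.
    (* [C X] is contained in [J X], hence in [C X0], so the two cores agree. As every bad prime over
       [C X] contains [e X], this would put [e X] into [C X]. *)
    move=> JP0; have [ne heX] := he X Xs.
    have CX : C X `<=` C X0 by move=> y Cy; apply: JP0 => Q _; apply.
    apply: ne; apply: (X0min X Xs CX); apply: JP0 => Q [PQ nQ] CQ.
    apply: contrapT => nQe; apply: nQ => n /G_coreP hn; apply/G_coreP.
    exact: heX hn.
  (* [x] avoids the core [P0] but perhaps not [P], so a translate of it is taken; translating the
     bad primes compensates. *)
  have [g Xg nxg] : exists2 g, X0 g & ~ spec_set P (a g x).
    move: nx => /existsNP[g /not_implyP[Xg ng]]; by exists g.
  exists (a g x); split=> // Q PQ nQ.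
  have bQ : bad (spec_act a g Q).
    split; last by rewrite G_core_act.
    by move=> y Py; apply: PQ; apply: G_core_stable; exists y.
  (* A bad prime contains the core of [P], which is the finite intersection of the sets [C X], so it
     contains one of them. *)
  have [X Xs CQ] : exists2 X, X \in s & C X `<=` spec_set (spec_act a g Q).
    apply: contrapT => none.
    have [X Xs|y [ny Cy]] := @prime_avoid_seq _ _ (spec_act a g Q) s C.
      split; first exact: core_ideal (spec_ideal P).
      by move=> sub; apply: none; exists X.
    by apply: ny; have [sub _] := bQ; apply: sub; apply/coreE.
  exact: (Jx X Xs (spec_act a g Q)).
exists x; split=> // Q PQ nQP; apply: hx => [|QP].
  by apply: subset_trans PQ; apply: G_core_sub.
(* Were every core of [Q] outside [C X0], some [y] outside [C X0] would lie in all of them, hence in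
   the core of [P]. If one is inside, so is [C X]; then the core of [Q] along [X] is no larger than
   that of [P], contrary to [core_grow]. *)
have [X Xs|y [ny Qy]] := @prime_avoid_seq _ _ P0 s (fun X => core a X (spec_set Q)).
  split; first exact: core_ideal (spec_ideal Q).
  move=> sub; have [r [rQ nr]] :=
    core_grow a_rational P_rational (spec_ideal Q) PQ nQP (hs X Xs).
  have CX : C X `<=` C X0 by move=> z Cz; apply: sub => g Xg; apply/PQ/Cz.
  by apply: nr; apply: (X0min X Xs CX); apply: sub.
by apply: ny; move: (QP y) => /(_ _)/coreE; apply; [apply/coreE|].
Qed.
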